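(* Let $(\mathcal G,N,M,\mathbf u)$ be an admissible instance (see context) such that $u_i=\lceil u_\psi\rceil$ for every $\psi\in\Psi$ with $u_\psi>1$ and every $i\in R^+(\psi)\setminus\{\psi\}$. Let $\mathcal X\subseteq\mathbb R^{|\mathcal V|}$ contain $\{\mathbf z\in\mathbb R^{|\mathcal V|}:\mathbf 0\le\mathbf z\le\mathbf u,\ z_i\le z_j\ \forall (i,j)\in\mathcal A\}$ and let $f:\mathcal X\to\mathbb R$ be DR-submodular with $f(\mathbf 0)=0$. Let $\mathcal P=\{(\mathbf z,w)\in\mathcal Z(\mathcal G,\mathbf u)\times\mathbb R: w\ge f(\mathbf z)\}$. Then $\mathrm{conv}(\mathcal P)$ is exactly the set of all $(\mathbf z,w)\in\mathbb R^{|\mathcal V|}\times\mathbb R$ satisfying (1) the box constraints $0\le z_i\le u_i$ for all $i\in\mathcal V$; (2) the monotonicity constraints $z_i-z_j\le 0$ for all $(i,j)\in\mathcal A$; (3) the MIR inequalities $-z_{\mathrm{ch}(\psi)}+\dfrac{z_\psi}{u_\psi-\lfloor u_\psi\rfloor}\le\dfrac{\lfloor u_\psi\rfloor(\lceil u_\psi\rceil-u_\psi)}{u_\psi-\lfloor u_\psi\rfloor}$ for all $\psi\in\Psi$; (4) the DR inequality $w\ge\sum_{k=1}^{|\mathcal V|}t(\delta,\mathbf z)_k\,[f(P(\delta,k))-f(P(\delta,k-1))]$ for every valid permutation $\delta$ of $\mathcal V$.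
   Context: **Instances.** $\mathcal V=\{1,\dots,n+m\}$ is partitioned into $N$ (indices of the $n$ integer variables) and $M$ (indices of the $m$ continuous variables); $n$ or $m$ may be $0$. $\mathcal G=(\mathcal V,\mathcal A)$ is a directed rooted forest: a disjoint union of directed rooted trees with all arcs pointing away from the roots. $R^+(i)$ is the set of vertices reachable from $i$ along arcs and $R^-(i)$ the set of vertices that can reach $i$; both contain $i$. $\mathrm{ch}(i)$ is the set of children of $i$; $\mathrm{depth}(i)$ is the number of arcs from the root of its component to $i$. For $\mathbf u\in\mathbb R^{|\mathcal V|}$, $\mathcal Z(\mathcal G,\mathbf u)=\{\mathbf z\in\mathbb R^{|\mathcal V|}: z_i\in\mathbb Z\ (i\in N),\ \mathbf 0\le\mathbf z\le\mathbf u,\ z_i\le z_j\ \forall(i,j)\in\mathcal A\}$ and $\Psi=\{\psi\in\mathcal V:u_\psi\notin\mathbb Z,\ R^+(\psi)\cap N\ne\emptyset\}$. The instance is *admissible* if: (a) $0<u_i<\infty$ for all $i$, $u_i\in\mathbb Z$ for $i\in N$, and $u_i\le u_j$ for $(i,j)\in\mathcal A$; (b) every directed path of $\mathcal G$ contains at most one vertex of $\Psi$; (c) every $\psi\in\Psi$ has exactly one child, denoted (abusing notation) $\mathrm{ch}(\psi)$, and $\mathrm{ch}(\psi)\in N$, $u_{\mathrm{ch}(\psi)}=\lceil u_\psi\rceil$. **Points $P(\mathcal S)$.** For $\mathcal S\subseteq\mathcal V$ and $i\in\mathcal V$, $i^{\vartriangle}(\mathcal S)$ is the vertex of maximum depth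 in $\mathcal S\cap R^-(i)$ if this set is nonempty, and $0$ otherwise. Put $u_0=0$, $z_0=0$. $P(\mathcal S)\in\mathbb R^{|\mathcal V|}$ is given by $P(\mathcal S)_i=\lfloor u_\psi\rfloor$ if $i^{\vartriangle}(\mathcal S)=\psi\in\Psi$ and $\mathrm{ch}(\psi)\notin\mathcal S$, and $P(\mathcal S)_i=u_{i^{\vartriangle}(\mathcal S)}$ otherwise. **Valid permutations.** For a permutation $\delta=(\delta(1),\dots,\delta(|\mathcal V|))$ of $\mathcal V$, $\delta^{-1}(i)$ is the position of $i$, $\mathcal T^{\delta,k}=\{\delta(1),\dots,\delta(k)\}$, $\mathcal T^{\delta,0}=\emptyset$, $P(\delta,k)=P(\mathcal T^{\delta,k})$. $\delta$ is *valid* if: (1) for distinct $i,j$ with $j\in R^+(i)$ and $u_i=u_j$, $\delta^{-1}(i)>\delta^{-1}(j)$; (2) for $\psi\in\Psi$ with $\lfloor u_\psi\rfloor=0$, $\delta^{-1}(\mathrm{ch}(\psi))<\delta^{-1}(\psi)$; (3) for $\psi\in\Psi$ and $i\in R^-(\psi)$ with $u_i=\lfloor u_\psi\rfloor$, it is not the case that $\delta^{-1}(i)<\delta^{-1}(\psi)<\delta^{-1}(\mathrm{ch}(\psi))$. **The function $\mathbf t$.** For $\psi\in\Psi$, $\eta_\psi(\mathbf z)=\dfrac{z_\psi-(u_\psi-\lfloor u_\psi\rfloor)z_{\mathrm{ch}(\psi)}}{u_{\mathrm{ch}(\psi)}-u_\psi}$. For valid $\delta$, $k\in\{1,\dots,|\mathcal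 V|\}$, with $i=\delta(k)$ and $i^{\vartriangle}=i^{\vartriangle}(\mathcal T^{\delta,k-1})$: $t(\delta,\mathbf z)_k=\dfrac{\eta_\psi(\mathbf z)-z_{i^{\vartriangle}}}{\lfloor u_\psi\rfloor-u_{i^{\vartriangle}}}$ if $i=\psi\in\Psi$ and $\mathrm{ch}(\psi)\notin\mathcal T^{\delta,k-1}$; else $t(\delta,\mathbf z)_k=\dfrac{z_i-\eta_\psi(\mathbf z)}{u_i-\lfloor u_\psi\rfloor}$ if $i^{\vartriangle}=\psi\in\Psi$; otherwise $t(\delta,\mathbf z)_k=\dfrac{z_i-z_{i^{\vartriangle}}}{u_i-u_{i^{\vartriangle}}}$. **DR-submodularity.** $f:\mathcal X\to\mathbb R$ is DR-submodular if $f(\mathbf x+\alpha\mathbf e^i)-f(\mathbf x)\ge f(\mathbf y+\alpha\mathbf e^i)-f(\mathbf y)$ for every $i$, all $\mathbf x\le\mathbf y$ (component-wise) in $\mathcal X$, and all $\alpha\ge0$ with $\mathbf x+\alpha\mathbf e^i,\mathbf y+\alpha\mathbf e^i\in\mathcal X$ ($\mathbf e^i$ the $i$-th unit vector).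
   Formalization: f is additionally assumed bounded below on Z(G,u); without this the claim fails (n=0, m=1, u=1, f a discontinuous additive function with f(1)=0), and the claimed description of conv(P) itself implies this bound. *)

(* Defs.v *)
From HB Require Import structures.
From mathcomp Require Import all_boot all_order all_fingroup all_algebra.
From mathcomp Require Import all_classical all_reals all_analysis.

Set Implicit Arguments.
Unset Strict Implicit.
Unset Printing Implicit Defensive.

Import Order.TTheory GRing.Theory Num.Theory.

Local Open Scope classical_set_scope.
Local Open Scope ring_scope.

(* Set of all finite convex combinations of points of [A]. *)
Definition convex_hull (R : realType) (E : lmodType R) (A : set E) : set E :=
  [set x | exists (k : nat) (c : 'I_k -> R) (p : 'I_k -> E),
     [/\ forall j, 0 <= c j, \sum_j c j = 1, forall j, A (p j)
       & x = \sum_j c j *: p j]].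

(* Only the values of [f] on [X] matter: a function X -> R is represented by a
   total function. *)
Definition DR_submodular (R : realType) (v : nat)
    (X : set 'rV[R]_v) (f : 'rV[R]_v -> R) : Prop :=
  forall (i : 'I_v) (x y : 'rV[R]_v) (a : R),
    X x -> X y -> (forall j, x 0 j <= y 0 j) -> 0 <= a ->
    X (x + a *: delta_mx 0 i) -> X (y + a *: delta_mx 0 i) ->
    f (y + a *: delta_mx 0 i) - f y <= f (x + a *: delta_mx 0 i) - f x.

Section Forest.
Context (v : nat) (arc : rel 'I_v).
Implicit Types (i j r : 'I_v) (p : seq 'I_v) (S : {set 'I_v}).

Definition is_root r : Prop := forall j, ~~ arc j r.

(* [r :: p] is a directed path from a root [r] to [i], with [size p] arcs. *)
Definition root_path r p i : Prop :=
  [/\ is_root r, path arc r p & last r p = i].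

(* Every vertex is reached from a unique root by a unique directed path, i.e.
   the digraph is a disjoint union of out-trees. *)
Definition rooted_forest : Prop :=
  forall i, exists! rp : 'I_v * seq 'I_v, root_path rp.1 rp.2 i.

Definition Rplus i : {set 'I_v} := [set j | connect arc i j]%SET.
Definition Rminus i : {set 'I_v} := [set j | connect arc j i]%SET.
Definition children i : {set 'I_v} := [set j | arc i j]%SET.

(* The child of a vertex with exactly one child; irrelevant otherwise. *)
Definition ch i : 'I_v := odflt i [pick j in children i].

Definition depth i : nat :=
  xget 0%N [set d | exists r p, root_path r p i /\ size p = d].

(* The vertex of maximum depth in S :&: Rminus i; [None] plays the role of the
   dummy vertex 0. *)
Definition triangle S i : option 'I_v :=
  [pick j in S :&: Rminus i
  | [forall k in S :&: Rminus i, (depth k <= depth j)%N]].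

(* The i-th coordinate, with value 0 at the dummy vertex. *)
Definition val0 (R : realType) (z : 'rV[R]_v) (o : option 'I_v) : R :=
  if o is Some j then z 0 j else 0.

End Forest.

Section Instance.
Context (R : realType) (v : nat).
Context (N : {set 'I_v}) (arc : rel 'I_v) (u : 'rV[R]_v).
Implicit Types (i j psi : 'I_v) (S : {set 'I_v}) (z : 'rV[R]_v) (d : 'S_v).

Definition ufloor i : R := (Num.floor (u 0 i))%:~R.
Definition uceil i : R := (Num.ceil (u 0 i))%:~R.

Definition relaxation : set 'rV[R]_v :=
  [set z : 'rV[R]_v | (forall i, 0 <= z 0 i <= u 0 i) /\
           (forall i j, arc i j -> z 0 i <= z 0 j)].

Definition feasible : set 'rV[R]_v :=
  [set z : 'rV[R]_v | (forall i, i \in N -> z 0 i \is a Num.int) /\ relaxation z].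

Definition Psi : {set 'I_v} :=
  [set psi | (u 0 psi \isn't a Num.int) &&
             [exists i in N, i \in Rplus arc psi]]%SET.

Definition admissible : Prop :=
  [/\ rooted_forest arc,
      [/\ forall i, 0 < u 0 i, forall i, i \in N -> u 0 i \is a Num.int
        & forall i j, arc i j -> u 0 i <= u 0 j],
      forall i p, path arc i p -> (count [in Psi] (i :: p) <= 1)%N
    & forall psi, psi \in Psi ->
        [/\ #|children arc psi| = 1%N, ch arc psi \in N
          & u 0 (ch arc psi) = uceil psi]].

Definition Pvec S : 'rV[R]_v :=
  \row_i match triangle arc S i with
         | Some j => if (j \in Psi) && (ch arc j \notin S)
                     then ufloor j else u 0 j
         | None => 0
         end.

(* Positions are counted from 0: [d k] is the vertex in position k + 1. *)
Definition pos d i : nat := (d^-1)%g i.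
Definition Tset d (k : nat) : {set 'I_v} := [set i | (pos d i < k)%N]%SET.

Definition valid_perm d : Prop :=
  [/\ forall i j, i != j -> j \in Rplus arc i -> u 0 i = u 0 j ->
        (pos d j < pos d i)%N,
      forall psi, psi \in Psi -> ufloor psi = 0 ->
        (pos d (ch arc psi) < pos d psi)%N
    & forall psi i, psi \in Psi -> i \in Rminus arc psi ->
        u 0 i = ufloor psi ->
        ~ (pos d i < pos d psi < pos d (ch arc psi))%N].

Definition eta psi z : R :=
  (z 0 psi - (u 0 psi - ufloor psi) * z 0 (ch arc psi)) /
  (u 0 (ch arc psi) - u 0 psi).

(* The coordinate of t(d, z) for the vertex in position k + 1, whose set of
   predecessors in [d] is [Tset d k]. *)
Definition tcoef d z (k : 'I_v) : R :=
  let i := d k in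
  let T := Tset d k in
  let a := triangle arc T i in
  let ordinary := (z 0 i - val0 z a) / (u 0 i - val0 u a) in
  if (i \in Psi) && (ch arc i \notin T)
  then (eta i z - val0 z a) / (ufloor i - val0 u a)
  else if a is Some psi then
    if psi \in Psi then (z 0 i - eta psi z) / (u 0 i - ufloor psi)
    else ordinary
  else ordinary.

Definition epigraph (f : 'rV[R]_v -> R) : set ('rV[R]_v * R^o) :=
  [set zw | feasible zw.1 /\ f zw.1 <= zw.2].

Definition MIR_inequality psi z : Prop :=
  - z 0 (ch arc psi) + z 0 psi / (u 0 psi - ufloor psi) <=
  ufloor psi * (uceil psi - u 0 psi) / (u 0 psi - ufloor psi).

Definition DR_inequality (f : 'rV[R]_v -> R) d z (w : R) : Prop :=
  \sum_(k < v) tcoef d z k *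
     (f (Pvec (Tset d k.+1)) - f (Pvec (Tset d k))) <= w.

End Instance.

(* Main.v *)
Require Import Defs.
From mathcomp Require Import all_boot all_order all_fingroup all_algebra.
From mathcomp Require Import all_classical all_reals all_analysis.
From mathcomp Require Import ring lra.

Set Implicit Arguments.
Unset Strict Implicit.
Unset Printing Implicit Defensive.

Import Order.TTheory GRing.Theory Num.Theory.

Local Open Scope classical_set_scope.
Local Open Scope ring_scope.

(** Every vertex [P(S)] is an "anchored" point: a coordinate copies the value of its deepest ancestor in [S].
    Applying the same copying rule to [(z, eta)] instead of [(u, floor u)], an insertion [T + i] moves both
    anchored points along one common direction, and [t(d, z)] is the ratio of the two displacements.

    A point of the polyhedron lies in the hull: inserting greedily a vertex of largest ratio (the deepest one
    in case of ties) produces a valid permutation along which [t(d, z)] decreases from at most 1 to at least 0,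
    so that [z] is a convex combination of the [P(d, k)]; the MIR inequalities say that the ratios are at most 1 at the start.

    Conversely, the DR inequality is affine in [z] and [f] is concave along nonnegative continuous moves, so one may
    move sets of tied fractional coordinates until the coordinates that reach [N] are integral, apart from
    [z_psi = u_psi].  Then [f z] telescopes along the anchored points of [(z, floor z)] and every increment is
    compared with that of [P(d, .)] by diminishing returns.  Replacing [floor z_psi] by [eta_psi] costs a
    multiple of the right-hand side evaluated at the unit vector of [eta_psi], whose sign is controlled by a second
    telescoping argument on the subtree of [psi] ([floor_ind_bound]). *)

(** * Rooted forests *)

(** The obstacle is a vertex [psi] with [z_psi] integral and [z_(ch psi) > z_psi]. Write [r] for the
    fractional part of [u_psi]. When [ch psi] is inserted after [psi], P(S) rises at [ch psi] and,
    by [r], also at [psi], whereas the anchored point of [(z, floor z)] moves at [ch psi] only.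
    Comparing increments therefore loses [z_(ch psi) - z_psi] times the share of [psi] in the
    increment of [f]. In exchange, [t] uses [eta_psi < floor z_psi]; as [t] is linear in that value,
    this gains [floor z_psi - eta_psi] times the right-hand side at the unit vector of [eta_psi]. By
    the definition of [eta_psi] the first multiplier is [(1 - r) / r] times the second, so one
    inequality per [psi], independent of [z], settles the balance. The assumption on the bounds
    below [psi] serves this comparison: if [psi] precedes [ch psi], all proper descendants of [psi]
    have the bound [floor u_psi + 1], and each of them inserted while [ch psi] is still missing, or
    [ch psi] itself, rises by exactly 1. Validity of a permutation is used as positivity of the
    denominators of [t]. *)

Section ForestTheory.
Context (v : nat) (arc : rel 'I_v).
Hypothesis forest : rooted_forest arc.
Implicit Types (i j a b k : 'I_v) (S : {set 'I_v}).
Local Notation le := (connect arc).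

Lemma root_path_rcons r p i j :
  root_path arc r p i -> arc i j -> root_path arc r (rcons p j) j.
Proof. by case=> rr rp <- ij; split; rewrite ?last_rcons // rcons_path rp. Qed.

Lemma root_path_uniq r p r' p' i :
  root_path arc r p i -> root_path arc r' p' i -> (r, p) = (r', p').
Proof.
move=> h h'; have [rp [_ uniq_rp]] := forest i.
by rewrite -(uniq_rp (r, p) h) -(uniq_rp (r', p') h').
Qed.

(** Extending the root paths of two parents of [k] by [k] gives two root paths to [k], which
    uniqueness identifies. *)
Lemma parent_uniq i j k : arc i k -> arc j k -> i = j.
Proof.
move=> ik jk; have [[r p] [/= hi _]] := forest i.
have [[r' p'] [/= hj _]] := forest j.
have [rr /rcons_inj[pp]] :=
  root_path_uniq (root_path_rcons hi ik) (root_path_rcons hj jk).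
by case: hi hj => _ _ <- [_ _ <-]; rewrite rr pp.
Qed.

Lemma depth_root_path r p i : root_path arc r p i -> depth arc i = size p.
Proof.
move=> h; rewrite /depth; apply: xget_unique; first by exists r, p.
by move=> d [r' [p' [h' <-]]]; case: (root_path_uniq h h') => _ ->.
Qed.

Lemma depth_arc i j : arc i j -> depth arc j = (depth arc i).+1.
Proof.
move=> ij; have [[r p] [/= hi _]] := forest i.
by rewrite (depth_root_path hi) (depth_root_path (root_path_rcons hi ij)) size_rcons.
Qed.

Lemma connect_depth i j : le i j -> i != j -> (depth arc i < depth arc j)%N.
Proof.
move=> /connectP [p pp ->]; elim: p i pp => [|k p IHp] i /=; first by rewrite eqxx.
move=> /andP[ik kp] _; have dik : (depth arc i < depth arc k)%N by rewrite (depth_arc ik).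
have [<-//|nk] := eqVneq k (last k p).
exact: ltn_trans dik (IHp k kp nk).
Qed.

Lemma connect_anti i j : le i j -> le j i -> i = j.
Proof.
move=> ij ji; apply/eqP/negPn/negP => nij.
have := ltn_trans (connect_depth ij nij) (connect_depth ji _).
by rewrite ltnn eq_sym => /(_ nij).
Qed.

Lemma connect_last_arc i j : le i j -> i != j -> exists2 k, le i k & arc k j.
Proof.
move=> /connectP [p pp ->]; case/lastP: p pp => [|p k] /=; first by rewrite eqxx.
rewrite last_rcons rcons_path => /andP[ip pk] _.
by exists (last i p) => //; apply/connectP; exists p.
Qed.

Lemma connect_first_arc i j : le i j -> i != j -> exists2 k, arc i k & le k j.
Proof.
move=> /connectP [[|k p] /= pp ->]; first by rewrite eqxx.
by case/andP: pp => ik kp _; exists k => //; apply/connectP; exists p.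
Qed.

Lemma connect_arc_inv i j k : le i k -> arc j k -> i != k -> le i j.
Proof.
by move=> ik jk nik; have [j' ij' /(parent_uniq jk) ->] := connect_last_arc ik nik.
Qed.

Lemma ancestors_chain a b i : le a i -> le b i -> le a b || le b a.
Proof.
move=> /connectP[p pp ->]; elim/last_ind: p pp => [|p k IHp] /=; first by move=> _ ->; rewrite orbT.
rewrite last_rcons rcons_path => /andP[ap pk] bk.
have ak : le a k.
  by apply: (connect_trans (y := last a p)); [apply/connectP; exists p | apply: connect1].
have [->|nbk] := eqVneq b k; first by rewrite ak.
exact: IHp ap (connect_arc_inv bk pk nbk).
Qed.

(** The ancestors of [i] form a chain along which depth increases strictly, so the deepest one in
    [S] is the nearest. Most later arguments on [triangle] use this description by [connect] instead
    of depth. *)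
Lemma triangleP S i :
  match triangle arc S i with
  | Some a => [/\ a \in S, le a i & forall b, b \in S -> le b i -> le b a]
  | None => forall b, b \in S -> ~~ le b i
  end.
Proof.
rewrite /triangle; case: pickP => [a|none].
  rewrite !inE => /andP[/andP[aS ai] /forallP amax]; split=> // b bS bi.
  have /implyP := amax b; rewrite !inE bS bi => /(_ isT) ba.
  have [//|lab] := orP (ancestors_chain bi ai).
  have [->|nab] := eqVneq a b; first exact: connect0.
  by have := connect_depth lab nab; rewrite ltnNge ba.
move=> b bS; apply/negP => bi.
have bP : b \in (S :&: Rminus arc i)%SET by rewrite !inE bS bi.
have [a aP amax] := @arg_maxnP _ b (mem (S :&: Rminus arc i)%SET) (depth arc) bP.
have /negP[] := none a; apply/andP; split=> //.
by apply/forallP => k; apply/implyP => kP; exact: amax.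
Qed.

Lemma triangle_SomeP S i a :
  triangle arc S i = Some a ->
  [/\ a \in S, le a i & forall b, b \in S -> le b i -> le b a].
Proof. by move=> h; have := triangleP S i; rewrite h. Qed.

Lemma triangle_NoneP S i b :
  triangle arc S i = None -> b \in S -> le b i -> False.
Proof. by move=> h bS; have := triangleP S i; rewrite h => /(_ b bS)/negP. Qed.

Lemma triangle_Some S i a : a \in S -> le a i ->
  (forall b, b \in S -> le b i -> le b a) -> triangle arc S i = Some a.
Proof.
move=> aS ai amax; have := triangleP S i; case: triangle => [b [bS bi bmax]|/(_ a aS)].
  by rewrite (connect_anti (amax b bS bi) (bmax a aS ai)).
by rewrite ai.
Qed.

Lemma triangle_self S i : i \in S -> triangle arc S i = Some i.
Proof. by move=> iS; apply: triangle_Some. Qed.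

Lemma eq_triangle S S' i j :
  (forall b, (b \in S) && le b i = (b \in S') && le b j) ->
  triangle arc S i = triangle arc S' j.
Proof.
move=> h; rewrite /triangle (_ : S :&: Rminus arc i = S' :&: Rminus arc j)%SET //.
by apply/setP => b; rewrite !inE h.
Qed.

Lemma triangle_above S i j : le i j ->
  (forall b, b \in S -> le b j -> le b i) -> triangle arc S j = triangle arc S i.
Proof.
move=> ij h; apply: eq_triangle => b; apply/andP/andP => -[bS bj]; split=> //.
  exact: h.
exact: connect_trans bj ij.
Qed.

Lemma triangleU1_Some S i j : triangle arc (i |: S)%SET j = Some i ->
  i \notin S -> triangle arc S j = triangle arc S i.
Proof.
move=> /triangle_SomeP[_ ij imax] iS; apply: triangle_above => // b bS bj.
by apply: imax => //; rewrite !inE bS orbT.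
Qed.

Lemma triangleU1_neq S i j : triangle arc (i |: S)%SET j != Some i ->
  triangle arc (i |: S)%SET j = triangle arc S j.
Proof.
move=> h; case e: (triangle arc (i |: S)%SET j) => [a|].
  have [aS aj amax] := triangle_SomeP e; symmetry; apply: triangle_Some => //.
    by move: aS; rewrite !inE => /orP[/eqP ai|//]; rewrite e ai eqxx in h.
  by move=> b bS bj; apply: amax => //; rewrite !inE bS orbT.
case e': (triangle arc S j) => [a|//].
have [aS aj _] := triangle_SomeP e'.
by have := triangle_NoneP e (b := a); rewrite !inE aS orbT aj => /(_ isT isT).
Qed.

End ForestTheory.

(** * Admissible instances and anchored points *)

Section AdmissibleInstance.
Context (R : realType) (v : nat) (N : {set 'I_v}) (arc : rel 'I_v) (u : 'rV[R]_v).
Hypothesis adm : admissible N arc u.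
Implicit Types (i j a b k psi : 'I_v) (S : {set 'I_v}) (x z : 'rV[R]_v) (y e : 'I_v -> R).
Local Notation le := (connect arc).
Local Notation Psi := (Psi N arc u).
Local Notation fl := (ufloor u).
Local Notation ch := (ch arc).
Local Notation K := (relaxation arc u).

Definition reachN i := [exists j in N, j \in Rplus arc i].

Lemma adm_forest : rooted_forest arc.
Proof. by case: adm. Qed.
Local Notation forest := adm_forest.

Lemma u_gt0 i : 0 < u 0 i.
Proof. by case: adm => _ [+ _ _] _ _; apply. Qed.

Lemma u_N i : i \in N -> u 0 i \is a Num.int.
Proof. by case: adm => _ [_ + _] _ _; apply. Qed.

Lemma relaxation_connect z i j : K z -> le i j -> z 0 i <= z 0 j.
Proof.
move=> [_ mz] /connectP[p + ->]; elim: p i => [|k p IHp] i //= /andP[ik kp].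
exact: le_trans (mz _ _ ik) (IHp _ kp).
Qed.

Lemma relaxation_u : K u.
Proof.
by split=> [i|]; [rewrite lexx ltW ?u_gt0 | case: adm => _ []].
Qed.

Lemma u_connect i j : le i j -> u 0 i <= u 0 j.
Proof. exact/relaxation_connect/relaxation_u. Qed.

Lemma reachN_connect i j : le i j -> reachN j -> reachN i.
Proof.
move=> ij /existsP[k /andP[kN]]; rewrite inE => jk; apply/existsP; exists k.
by rewrite kN inE (connect_trans ij jk).
Qed.

Lemma N_reachN i : i \in N -> reachN i.
Proof. by move=> iN; apply/existsP; exists i; rewrite iN inE connect0. Qed.

Lemma PsiE psi : (psi \in Psi) = (u 0 psi \isn't a Num.int) && reachN psi.
Proof. by rewrite inE. Qed.

Lemma reachN_int i : reachN i -> i \notin Psi -> u 0 i \is a Num.int.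
Proof. by rewrite PsiE => ->; rewrite andbT negbK. Qed.

Lemma Psi_reachN psi : psi \in Psi -> reachN psi.
Proof. by rewrite PsiE => /andP[]. Qed.

Lemma Psi_nint psi : psi \in Psi -> u 0 psi \isn't a Num.int.
Proof. by rewrite PsiE => /andP[]. Qed.

Lemma Psi_notN psi : psi \in Psi -> psi \notin N.
Proof. by move=> /Psi_nint; apply: contra => /u_N. Qed.

Lemma ch_N psi : psi \in Psi -> ch psi \in N.
Proof. by case: adm => _ _ _ h /h[]. Qed.

Lemma ch_notPsi psi : psi \in Psi -> ch psi \notin Psi.
Proof. by move=> /ch_N chN; apply/negP => /Psi_notN; rewrite chN. Qed.

Lemma ch_children psi : psi \in Psi -> children arc psi = [set ch psi]%SET.
Proof.
case: adm => _ _ _ h /h[/eqP/cards1P[c cE] _ _]; rewrite cE; congr [set _]%SET.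
rewrite /ch; case: pickP => [j|/(_ c)]; rewrite cE inE; first by move/eqP.
by rewrite eqxx.
Qed.

Lemma arc_ch psi : psi \in Psi -> arc psi (ch psi).
Proof. by move=> /ch_children/setP/(_ (ch psi)); rewrite !inE eqxx. Qed.

Lemma arc_Psi psi j : psi \in Psi -> arc psi j -> j = ch psi.
Proof. by move=> /ch_children/setP/(_ j); rewrite !inE => -> /eqP. Qed.

Lemma connect_ch psi : psi \in Psi -> le psi (ch psi).
Proof. by move=> /arc_ch/connect1. Qed.

Lemma connect_Psi psi j : psi \in Psi -> le psi j -> j != psi -> le (ch psi) j.
Proof.
move=> pP pj; rewrite eq_sym => /(connect_first_arc pj)[k pk kj].
by rewrite -(arc_Psi pP pk).
Qed.

Lemma ch_neq psi : psi \in Psi -> ch psi != psi.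
Proof. by move=> pP; apply/eqP => e; have := ch_notPsi pP; rewrite e pP. Qed.

Lemma ch_nconnect psi : psi \in Psi -> ~~ le (ch psi) psi.
Proof.
move=> pP; apply/negP => h; have := connect_anti forest h (connect_ch pP).
by move/eqP; rewrite (negbTE (ch_neq pP)).
Qed.

Lemma ch_inj psi psi' : psi \in Psi -> psi' \in Psi -> ch psi = ch psi' -> psi = psi'.
Proof.
move=> pP pP' e; apply: (parent_uniq forest (arc_ch pP)).
by rewrite e; apply: arc_ch.
Qed.

Lemma connect_to_ch psi i : psi \in Psi -> le i (ch psi) -> i != ch psi -> le i psi.
Proof. by move=> pP ip; exact: (connect_arc_inv forest ip (arc_ch pP)). Qed.

Lemma Psi_antichain psi psi' : psi \in Psi -> psi' \in Psi -> le psi psi' -> psi = psi'.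
Proof.
move=> pP pP' /connectP[p pp e]; case: adm => _ _ /(_ _ _ pp) + _.
rewrite /= pP; case/lastP: p pp e => [//|p k] _; rewrite last_rcons => <-.
by rewrite -cats1 count_cat /= pP' addn0 addn1 add1n.
Qed.

Lemma fl_int psi : fl psi \is a Num.int.
Proof. exact: intr_int. Qed.

Lemma fl_lt psi : psi \in Psi -> fl psi < u 0 psi.
Proof.
move=> /Psi_nint h; rewrite lt_neqAle floor_le andbT.
by move: h; rewrite intrEfloor.
Qed.

Lemma u_lt_fl1 psi : u 0 psi < fl psi + 1.
Proof. by rewrite /ufloor -[1]/(1%:~R) -intrD; exact: floorD1_gt. Qed.

Lemma u_ch psi : psi \in Psi -> u 0 (ch psi) = fl psi + 1.
Proof.
move=> pP; case: adm => _ _ _ /(_ _ pP)[_ _ ->].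
by rewrite /uceil real_ceil_floor ?num_real // (Psi_nint pP) intrD.
Qed.

Lemma fl_ge0 psi : 0 <= fl psi.
Proof. by rewrite /ufloor ler0z real_floor_ge0 ?num_real // ltW // u_gt0. Qed.

Lemma int_le_floor (a b : R) : a \is a Num.int -> a <= b -> a <= (Num.floor b)%:~R.
Proof. by move=> /intrP[m ->] h; rewrite ler_int real_floor_ge_int ?num_real. Qed.

Lemma int_ltD1 (a b : R) : a \is a Num.int -> b \is a Num.int -> a < b -> a + 1 <= b.
Proof.
by move=> /intrP[m ->] /intrP[n ->]; rewrite -[1]/(1%:~R) -intrD ltr_int ler_int -lezD1.
Qed.

Lemma above_Psi_notPsi psi a : psi \in Psi -> le a psi -> a != psi -> a \notin Psi.
Proof. by move=> pP ap; apply: contra => aP; rewrite (Psi_antichain aP pP ap). Qed.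

Lemma below_Psi_notPsi psi a : psi \in Psi -> le psi a -> a != psi -> a \notin Psi.
Proof. by move=> pP ap; apply: contra => aP; rewrite (Psi_antichain pP aP ap). Qed.

Lemma above_Psi_int psi a : psi \in Psi -> le a psi -> a != psi -> u 0 a \is a Num.int.
Proof.
move=> pP ap nap; apply: reachN_int (above_Psi_notPsi pP ap nap).
exact: reachN_connect ap (Psi_reachN pP).
Qed.

Lemma above_Psi_le psi a : psi \in Psi -> le a psi -> a != psi -> u 0 a <= fl psi.
Proof.
by move=> pP ap nap; rewrite int_le_floor ?(above_Psi_int pP) ?u_connect.
Qed.

Lemma below_Psi_ge psi a : psi \in Psi -> le psi a -> a != psi -> fl psi + 1 <= u 0 a.
Proof. by move=> pP ap nap; rewrite -u_ch // u_connect // connect_Psi. Qed.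

Definition ext S (g : 'I_v -> R) : 'rV[R]_v :=
  \row_i (if triangle arc S i is Some a then g a else 0).

(* With [(y, e) = (u, floor u)] these are the coordinates of P(S); with [(z, eta)] the quotients of
   [gap] are the coordinates of t (see [tcoef_gap]). *)
Definition aval (y e : 'I_v -> R) S a : R :=
  if (a \in Psi) && (ch a \notin S) then e a else y a.

Definition anch y e S := ext S (aval y e S).

Definition gap y e S i : R := aval y e S i - anch y e S 0 i.

Lemma Pvec_anch S : Pvec N arc u S = anch (u 0) fl S.
Proof. by apply/rowP => i; rewrite !mxE. Qed.

Lemma ext_self S g i : i \in S -> ext S g 0 i = g i.
Proof. by move=> iS; rewrite mxE triangle_self //; exact: forest. Qed.

Lemma avalU1_self y e S i : aval y e (i |: S)%SET i = aval y e S i.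
Proof.
rewrite /aval; case iP: (i \in Psi) => //=.
by rewrite !inE (negbTE (ch_neq iP)).
Qed.

Lemma triangle_ch psi S : psi \in Psi -> psi \in S -> ch psi \notin S ->
  triangle arc S (ch psi) = Some psi.
Proof.
move=> pP pS cS; apply: (triangle_Some forest) => //; first exact: connect_ch.
move=> b bS; move=> /(connect_to_ch pP) -> //.
by apply: contraNneq cS => <-.
Qed.

(** Coordinates that start copying [i] move by the whole gap of [i]. The only other coordinate that
    moves is a [psi] in [S] with child [i]: it is released from [e psi] to [y psi], a fraction
    [u_psi - floor u_psi] of the gap. Neither [y] nor [e] occurs in the direction. *)
Definition stepdir S i : 'rV[R]_v :=
  \row_j (if triangle arc (i |: S)%SET j == Some i then 1
          else if [&& j \in Psi, j \in S & ch j == i] then u 0 j - fl j else 0).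

Lemma anch_step y e S i : i \notin S ->
  (forall psi, psi \in Psi -> psi \in S -> ch psi = i ->
     y psi = e psi + (u 0 psi - fl psi) * (y i - e psi)) ->
  anch y e (i |: S)%SET = anch y e S + gap y e S i *: stepdir S i.
Proof.
move=> iS rel; apply/rowP => j; rewrite !mxE.
have [tj|tj] := eqVneq (triangle arc (i |: S)%SET j) (Some i).
  rewrite tj avalU1_self (triangleU1_Some forest tj iS) mulr1 /gap mxE.
  by rewrite addrC subrK.
rewrite (triangleU1_neq forest tj); case: ifPn => [/and3P[jP jS /eqP cj]|hj].
  have cS : ch j \notin S by rewrite cj.
  rewrite (triangle_self forest jS) /gap mxE -cj (triangle_ch jP jS cS) cj.
  have iP : i \notin Psi by rewrite -cj ch_notPsi.
  rewrite /aval jP cj (negbTE iS) !in_setU1 eqxx (negbTE iP) /=.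
  by rewrite (rel j) // mulrC.
rewrite mulr0 addr0; case tS: (triangle arc S j) => [a|//].
have [aS aj amax] := triangle_SomeP forest tS.
rewrite /aval; case aP: (a \in Psi) => //=; rewrite !inE.
(* The value at the anchor [a] changes only if [ch a = i]; but then a [j] other than [a] that copies
   [a] lies below [i], and would copy [i] or something deeper. *)
have [ca|//] := eqVneq (ch a) i.
have [ja|nja] := eqVneq j a; first by rewrite ja aP aS ca eqxx in hj.
have ij : le i j by rewrite -ca; apply: connect_Psi.
have := triangleP forest (i |: S)%SET j; rewrite (triangleU1_neq forest tj) tS.
move=> [_ _ /(_ i)]; rewrite setU11 => /(_ isT ij); rewrite -ca => h.
by have := ch_nconnect aP; rewrite h.
Qed.

End AdmissibleInstance.

(** * Prefixes of a permutation *)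

Section Positions.
Context (v : nat) (d : 'S_v).
Implicit Types (i : 'I_v) (k : nat).

Lemma in_Tset i k : (i \in Tset d k) = (pos d i < k)%N.
Proof. by rewrite inE. Qed.

Lemma pos_perm (k : 'I_v) : pos d (d k) = k.
Proof. by rewrite /pos permK. Qed.

Lemma perm_pos i : d ((d^-1)%g i) = i.
Proof. exact: permKV. Qed.

Lemma pos_inj : injective (pos d).
Proof. by move=> i j /val_inj/perm_inj. Qed.

Lemma Tset0 : Tset d 0 = finset.set0.
Proof. by apply/setP => i; rewrite !inE. Qed.

Lemma Tset_full : Tset d v = [set: 'I_v]%SET.
Proof. by apply/setP => i; rewrite !inE ltn_ord. Qed.

Lemma TsetS (k : 'I_v) : Tset d k.+1 = (d k |: Tset d k)%SET.
Proof.
apply/setP => i; rewrite !inE ltnS leq_eqVlt; congr (_ || _).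
by rewrite -(pos_perm k) (inj_eq pos_inj).
Qed.

Lemma Tset_perm (k : 'I_v) : d k \notin Tset d k.
Proof. by rewrite in_Tset pos_perm ltnn. Qed.

End Positions.

(** * Anchored points and the coefficients [t] as ratios of gaps *)

Section AnchoredPoints.
Context (R : realType) (v : nat) (N : {set 'I_v}) (arc : rel 'I_v) (u : 'rV[R]_v).
Hypothesis adm : admissible N arc u.
Implicit Types (i j a b k psi : 'I_v) (S : {set 'I_v}) (x z : 'rV[R]_v).
Implicit Types (y e : 'I_v -> R).
Local Notation le := (connect arc).
Local Notation Psi := (Psi N arc u).
Local Notation fl := (ufloor u).
Local Notation ch := (ch arc).
Local Notation K := (relaxation arc u).
Local Notation forest := (adm_forest adm).
Local Notation aval := (aval N arc u).
Local Notation anch := (anch N arc u).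
Local Notation gap := (gap N arc u).
Local Notation eta := (eta arc u).

(** [eta] is the solution of this equation, which is what [anch_step] requires of [e]; [floor_rel]
    is the same equation for [(u, floor u)]. *)
Lemma eta_rel psi z : psi \in Psi ->
  z 0 psi = eta psi z + (u 0 psi - fl psi) * (z 0 (ch psi) - eta psi z).
Proof.
move=> pP; rewrite /eta (u_ch adm pP); have := u_lt_fl1 u psi.
rewrite -subr_gt0 => /lt0r_neq0 h; field; exact: h.
Qed.

Lemma floor_rel psi : psi \in Psi ->
  u 0 psi = fl psi + (u 0 psi - fl psi) * (u 0 (ch psi) - fl psi).
Proof. by move=> pP; rewrite (u_ch adm pP); ring. Qed.

(** The cases of [t] are those of [aval] at [d k] and at its nearest inserted ancestor. Two
    combinations missing from [t] cannot occur: two vertices of [Psi] on one path, and an ancestor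
    in [Psi] whose child is inserted, since that child is nearer. *)
Lemma tcoef_gap (d : 'S_v) z (k : 'I_v) :
  tcoef N arc u d z k = gap (z 0) (eta^~ z) (Tset d k) (d k) /
                        gap (u 0) fl (Tset d k) (d k).
Proof.
rewrite /tcoef /gap /anch !mxE /aval; set i := d k; set T := Tset d k.
have iT : i \notin T := Tset_perm d k.
case: ifPn => [iP|niP].
  case tT: (triangle arc T i) => [a|//=].
  rewrite (_ : _ && _ = false) //; apply/negP => /andP[aP caT].
  have [aT ai _] := triangle_SomeP forest tT; case/andP: iP => iP _.
  by move: iT; rewrite -(Psi_antichain adm aP iP ai) aT.
case tT: (triangle arc T i) => [a|//=].
case: ifPn => aP //=; case: ifPn => //; rewrite negbK => caT.
have [aT ai amax] := triangle_SomeP forest tT.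
have nia : i != a by apply: contraNneq iT => ->.
have := amax _ caT (connect_Psi adm aP ai nia).
by rewrite (negbTE (ch_nconnect adm aP)).
Qed.

Lemma ext_relaxation S g :
  (forall a, a \in S -> 0 <= g a <= u 0 a) ->
  (forall a b, a \in S -> b \in S -> le a b -> g a <= g b) ->
  K (ext arc S g).
Proof.
move=> gb gm; split=> [i|i j ij]; rewrite !mxE.
  case t: triangle => [a|]; last by rewrite lexx ltW ?(u_gt0 adm).
  have [aS ai _] := triangle_SomeP forest t; have /andP[-> ga] := gb a aS.
  exact: le_trans ga (u_connect adm ai).
have lij := connect1 ij.
case ti: (triangle arc S i) => [a|].
  have [aS ai _] := triangle_SomeP forest ti.
  have aj := connect_trans ai lij.
  case tj: (triangle arc S j) => [b|]; last by have := triangle_NoneP forest tj aS aj.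
  have [bS bj bmax] := triangle_SomeP forest tj; exact: gm (bmax _ aS aj).
by case tj: (triangle arc S j) => [b|//]; have [bS _ _] := triangle_SomeP forest tj; case/andP: (gb b bS).
Qed.

(** What makes anchored values monotone along paths. It holds for [(u, floor u)] and for
    [(z, floor z)] at reduced points; it may fail for [(z, eta)], because [eta] can be negative. *)
Definition anchorable z e :=
  [/\ K z, forall psi, psi \in Psi -> 0 <= e psi <= z 0 psi
    & forall psi a, psi \in Psi -> le a psi -> a != psi -> z 0 a <= e psi].

Lemma anchorable_u : anchorable u fl.
Proof.
split; first exact: relaxation_u adm.
- by move=> psi pP; rewrite (fl_ge0 adm) ltW // (fl_lt pP).
- by move=> psi a; apply: above_Psi_le.
Qed.

Section Anchorable.
Variables (z : 'rV[R]_v) (e : 'I_v -> R).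
Hypothesis ze : anchorable z e.

Lemma aval_ge0 S a : 0 <= aval (z 0) e S a.
Proof.
case: ze => -[zb _] eb _; rewrite /aval; case: ifPn => [/andP[aP _]|_].
  by case/andP: (eb a aP).
by case/andP: (zb a).
Qed.

Lemma aval_le S a : aval (z 0) e S a <= z 0 a.
Proof.
case: ze => _ eb _; rewrite /aval; case: ifPn => // /andP[aP _].
by case/andP: (eb a aP).
Qed.

Lemma aval_mono S a b : le a b -> aval (z 0) e S a <= aval (z 0) e S b.
Proof.
move=> ab; have [->//|nab] := eqVneq a b; apply: le_trans (aval_le S a) _.
case: ze => Kz _ em; rewrite /aval; case: ifPn => [/andP[bP _]|_].
  exact: em.
exact: relaxation_connect Kz ab.
Qed.

Lemma gap_ge0 S i : 0 <= gap (z 0) e S i.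
Proof.
rewrite /gap mxE subr_ge0; case t: triangle => [a|]; last exact: aval_ge0.
by have [_ ai _] := triangle_SomeP forest t; apply: aval_mono.
Qed.

Lemma anch_relaxation S : K (anch (z 0) e S).
Proof.
apply: ext_relaxation => [a _|a b _ _]; last exact: aval_mono.
rewrite aval_ge0 (le_trans (aval_le S a)) //.
by case: ze => -[zb _] _ _; case/andP: (zb a).
Qed.

Lemma anch_int S i :
  (forall a, reachN N arc a -> a \notin Psi -> z 0 a \is a Num.int) ->
  (forall psi, psi \in Psi -> e psi \is a Num.int) ->
  reachN N arc i -> i \notin Psi -> anch (z 0) e S 0 i \is a Num.int.
Proof.
move=> zi ei ri iP; rewrite mxE; case t: triangle => [a|]; last exact: int_num0.
have [aS ai amax] := triangle_SomeP forest t; rewrite /aval.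
case: ifPn => [/andP[aP _]|]; first exact: ei.
have [aP|aP] /= := boolP (a \in Psi); last first.
  by move=> _; apply: zi => //; apply: reachN_connect ai ri.
have nia : i != a by apply: contraNneq iP => ->.
rewrite negbK => caS; have := amax _ caS (connect_Psi adm aP ai nia).
by rewrite (negbTE (ch_nconnect adm aP)).
Qed.

Lemma anch_feasible S :
  (forall a, reachN N arc a -> a \notin Psi -> z 0 a \is a Num.int) ->
  (forall psi, psi \in Psi -> e psi \is a Num.int) ->
  feasible N arc u (anch (z 0) e S).
Proof.
move=> zi ei; split; last exact: anch_relaxation.
move=> i iN; apply: anch_int => //; first exact: N_reachN.
by apply/negP => /(Psi_notN adm); rewrite iN.
Qed.

Lemma anch_le S j : (forall psi, psi \in Psi -> e psi <= fl psi) ->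
  anch (z 0) e S 0 j <= Pvec N arc u S 0 j.
Proof.
move=> ef; rewrite Pvec_anch !mxE; case t: triangle => [a|//].
rewrite /aval; case: ifPn => [/andP[aP _]|_]; first exact: ef.
by case: ze => -[zb _] _ _; case/andP: (zb a).
Qed.

End Anchorable.

Lemma Pvec_relaxation S : K (Pvec N arc u S).
Proof. by rewrite Pvec_anch; apply: anch_relaxation anchorable_u S. Qed.

Lemma Pvec_feasible S : feasible N arc u (Pvec N arc u S).
Proof.
rewrite Pvec_anch; apply: (anch_feasible anchorable_u).
- by move=> a; apply: reachN_int.
- by move=> psi _; apply: fl_int.
Qed.

Lemma anch_set0 y e : anch y e finset.set0 = 0.
Proof.
apply/rowP => i; rewrite !mxE; case t: triangle => [a|//].
by have [] := triangle_SomeP forest t; rewrite inE.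
Qed.

Lemma anch_setT y e : anch y e [set: 'I_v]%SET = \row_i y i.
Proof.
apply/rowP => i; rewrite [RHS]mxE.
transitivity (aval y e [set: 'I_v]%SET i); first by apply: (ext_self adm); rewrite inE.
by rewrite /aval finset.in_setT andbF.
Qed.

Lemma anch_row z e : anch (z 0) e [set: 'I_v]%SET = z.
Proof. by rewrite anch_setT; apply/rowP => i; rewrite mxE. Qed.

Section Linearity.
Variables (y e y' e' : 'I_v -> R) (c : R).
Let y1 i := y i + c * y' i.
Let e1 i := e i + c * e' i.

Lemma aval_lin S a : aval y1 e1 S a = aval y e S a + c * aval y' e' S a.
Proof. by rewrite /aval; case: ifP. Qed.

Lemma anch_lin S i : anch y1 e1 S 0 i = anch y e S 0 i + c * anch y' e' S 0 i.
Proof. by rewrite !mxE; case: triangle => [a|]; rewrite ?aval_lin // mulr0 addr0. Qed.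

Lemma gap_lin S i : gap y1 e1 S i = gap y e S i + c * gap y' e' S i.
Proof. by rewrite /gap aval_lin anch_lin; ring. Qed.

End Linearity.

Lemma eta_lin psi c x z : eta psi (c *: x + z) = eta psi z + c * eta psi x.
Proof. by rewrite /Defs.eta !mxE; ring. Qed.

Lemma tcoef_lin d c x z k :
  tcoef N arc u d (c *: x + z) k = tcoef N arc u d z k + c * tcoef N arc u d x k.
Proof.
rewrite !tcoef_gap mulrA -mulrDl -gap_lin; congr (gap _ _ _ _ / _).
- by apply/funext => i; rewrite !mxE addrC.
- by apply/funext => i; rewrite eta_lin.
Qed.

End AnchoredPoints.

(** * Concavity of DR-submodular functions *)

(* [D] only has to be stable under the doubling map of the unit interval: a violation of the
   chord inequality at [s] at least doubles at the image of [s], contradicting the lower bound. *)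
Lemma midpoint_concave_orbit (R : realType) (h : R -> R) (D : R -> Prop) :
  (forall s t : R, 0 <= s -> s <= t -> t <= 1 -> h s + h t <= 2 * h ((s + t) / 2)) ->
  (forall s, D s -> 0 <= s <= 1) ->
  (forall s, D s -> s <= 1 / 2 -> D (2 * s)) ->
  (forall s, D s -> 1 / 2 <= s -> D (2 * s - 1)) ->
  (exists b, forall s, D s -> b <= h s) ->
  forall s, D s -> (1 - s) * h 0 + s * h 1 <= h s.
Proof.
move=> mid D01 Dl Dr [b hb] s0 Ds0; rewrite leNgt; apply/negP => bad.
pose g s := h s - (1 - s) * h 0 - s * h 1.
pose c := - g s0; have c0 : 0 < c by rewrite /c /g; lra.
(* The defect [g] vanishes at 0 and 1, and [s] is the midpoint of 0 and [2 * s] or of [2 * s - 1]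
   and 1. Hence the defect doubles at each step; linear growth is all that the Archimedean argument
   requires. *)
have dbl n : exists2 s, D s & g s <= - (n.+1%:R * c).
  elim: n => [|n [s Ds gs]]; first by exists s0 => //; rewrite mul1r /c opprK.
  have /andP[s_ge0 s_le1] := D01 s Ds.
  have gs2 : 2 * g s <= - (n.+2%:R * c).
    apply: (@le_trans _ _ (2 * - (n.+1%:R * c))); first by rewrite ler_pM2l.
    by rewrite mulrN lerN2 mulrA ler_pM2r // -natrM ler_nat mul2n -addnn -(add1n n.+1) leq_add2r.
  have [sl|sr] := leP s (1 / 2).
    exists (2 * s); first exact: Dl.
    have := mid 0 (2 * s) (lexx 0); rewrite add0r (_ : 2 * s / 2 = s); last by field.
    by move=> /(_ ltac:(lra) ltac:(lra)); move: gs2; rewrite /g; lra.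
  exists (2 * s - 1); first by apply: Dr => //; exact: ltW.
  have := mid (2 * s - 1) 1; rewrite (_ : (2 * s - 1 + 1) / 2 = s); last by field.
  by move=> /(_ ltac:(lra) ltac:(lra) (lexx 1)); move: gs2; rewrite /g; lra.
pose M := `|b| + `|h 0| + `|h 1|.
have [s Ds gs] := dbl (Num.bound (M / c)).
have M0 : 0 <= M / c by apply: divr_ge0; [rewrite /M !addr_ge0 | exact: ltW].
have := archi_boundP M0; rewrite ltr_pdivrMr // => Mc.
have : M < (Num.bound (M / c)).+1%:R * c.
  by apply: lt_le_trans Mc _; rewrite ler_pM2r // ler_nat.
have := hb s Ds; have /andP[s_ge0 s_le1] := D01 s Ds.
have : (1 - s) * h 0 <= `|h 0|.
  apply: le_trans (ler_norm _) _; rewrite normrM ler_piMl // ger0_norm; lra.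
have : s * h 1 <= `|h 1|.
  by apply: le_trans (ler_norm _) _; rewrite normrM ler_piMl // ger0_norm; lra.
have := ler_norm (- b); rewrite normrN.
move: gs; rewrite /g /M; lra.
Qed.

Definition nonneg_ratio (R : realType) (t : R) : Prop :=
  exists p q : nat, (0 < q)%N /\ t = p%:R / q%:R.

Lemma int_nonneg_ratio (R : realType) (a b : R) :
  a \is a Num.int -> b \is a Num.int -> 0 <= a -> 0 < b -> nonneg_ratio (a / b).
Proof.
move=> ai bi a0 b0; have /natrP[p ->] : a \is a Num.nat by rewrite natrEint ai.
have : b \is a Num.nat by rewrite natrEint bi ltW.
by case/natrP => q eb; move: b0; rewrite eb ltr0n => q0; exists p, q.
Qed.

Section DRConcavity.
Context (R : realType) (v : nat) (N : {set 'I_v}) (arc : rel 'I_v) (u : 'rV[R]_v).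
Hypothesis adm : admissible N arc u.
Local Notation K := (relaxation arc u).
Local Notation feas := (feasible N arc u).
Local Notation forest := (adm_forest adm).
Context (X : set 'rV[R]_v) (X_relaxation : K `<=` X).
Context (f : 'rV[R]_v -> R) (f_DR : DR_submodular X f).
Hypothesis f_bounded : exists b : R, forall z, feas z -> b <= f z.
Implicit Types (x y z d : 'rV[R]_v) (s t : R) (S : {set 'I_v}).

Lemma relaxation_convex x d s : K x -> K (x + d) -> 0 <= s <= 1 -> K (x + s *: d).
Proof.
move=> [xb xm] [db dm] /andP[s0 s1]; split=> [i|i j ij].
  have := xb i; have := db i; rewrite !mxE => /andP[? ?] /andP[? ?]; nra.
have := xm _ _ ij; have := dm _ _ ij; rewrite !mxE; nra.
Qed.

Definition mask_row S d : 'rV[R]_v := \row_j (if j \in S then d 0 j else 0).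

Lemma mask_row_relaxation z d S : (forall i j, i \in S -> arc i j -> j \in S) ->
  (forall j, 0 <= d 0 j) -> K z -> K (z + d) -> K (z + mask_row S d).
Proof.
move=> cl d0 [zb zm] [db dm]; split=> [i|i j ij].
  have := zb i; have := db i; rewrite !mxE; case: ifP => _; lra.
have := zm _ _ ij; have := dm _ _ ij; rewrite !mxE.
have := cl i j; case: (i \in S) => [/(_ isT ij) -> //|_].
by case: (j \in S); have := d0 i; have := d0 j; lra.
Qed.

(** A sum of single-coordinate inequalities. The shallowest vertex of [S] is raised last: what
    remains is still closed under arcs, so no intermediate point violates monotonicity. *)
Lemma DR_set x y d S : K x -> K y -> K (x + d) -> K (y + d) ->
  (forall j, x 0 j <= y 0 j) -> (forall j, 0 <= d 0 j) ->
  (forall i j, i \in S -> arc i j -> j \in S) ->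
  f (y + mask_row S d) - f y <= f (x + mask_row S d) - f x.
Proof.
move=> Kx Ky Kxd Kyd xy d0.
have KS S' z : (forall i j, i \in S' -> arc i j -> j \in S') -> K z -> K (z + d) ->
    K (z + mask_row S' d) by move=> *; apply: mask_row_relaxation.
have [n] := ubnP #|S|; elim: n S => // n IHn S /ltnSE Sn cl.
have [->|[i0 i0S]] := set_0Vmem S.
  suff -> : mask_row finset.set0 d = 0 by rewrite !addr0 !subrr.
  by apply/rowP => j; rewrite !mxE inE.
have [i iS imin] := @arg_minnP _ i0 (fun j => j \in S) (depth arc) i0S.
have clD : forall j k, j \in (S :\ i)%SET -> arc j k -> k \in (S :\ i)%SET.
  move=> j k; rewrite !inE => /andP[nji jS] jk; rewrite (cl j k jS jk) andbT.
  apply/eqP => ki; have := imin j jS; rewrite -ki (depth_arc forest jk) ltnn //.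
have eS : mask_row S d = mask_row (S :\ i)%SET d + d 0 i *: delta_mx 0 i.
  apply/rowP => j; rewrite !mxE !inE eqxx /=.
  have [->|_] := eqVneq j i; first by rewrite iS mulr1 add0r.
  by rewrite mulr0 addr0.
have cD : (#|S :\ i| < n)%N by move: Sn; rewrite (cardsD1 i) iS.
have IH := IHn _ cD clD; rewrite eS !addrA.
suff : f (y + mask_row (S :\ i)%SET d + d 0 i *: delta_mx 0 i) -
       f (y + mask_row (S :\ i)%SET d) <=
       f (x + mask_row (S :\ i)%SET d + d 0 i *: delta_mx 0 i) -
       f (x + mask_row (S :\ i)%SET d) by lra.
apply: f_DR => //; first by apply/X_relaxation/KS.
- by apply/X_relaxation/KS.
- by move=> j; rewrite !mxE lerD2r.
- by apply: X_relaxation; rewrite -addrA -eS; apply: KS.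
- by apply: X_relaxation; rewrite -addrA -eS; apply: KS.
Qed.

Lemma DR_relaxation x y d : K x -> K y -> K (x + d) -> K (y + d) ->
  (forall j, x 0 j <= y 0 j) -> (forall j, 0 <= d 0 j) ->
  f (y + d) - f y <= f (x + d) - f x.
Proof.
move=> Kx Ky Kxd Kyd xy d0; rewrite (_ : d = mask_row [set: 'I_v]%SET d).
  by apply: DR_set => // *; rewrite inE.
by apply/rowP => j; rewrite mxE finset.in_setT.
Qed.

(* Without continuity, [f] is only known to be concave along rational steps and along segments on
   which it is bounded below. *)
Lemma concave_segment x d s : K x -> K (x + d) -> (forall j, 0 <= d 0 j) ->
  0 <= s <= 1 ->
  nonneg_ratio s \/ (feas x /\ forall j, j \in N -> d 0 j = 0) ->
  (1 - s) * f x + s * f (x + d) <= f (x + s *: d).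
Proof.
move=> Kx Kxd d0 s01; pose h r := f (x + r *: d).
have mid (r t : R) : 0 <= r -> r <= t -> t <= 1 -> h r + h t <= 2 * h ((r + t) / 2).
  move=> r0 rt t1; pose m := (r + t) / 2; pose e := (m - r) *: d.
  have e1 : x + r *: d + e = x + m *: d by rewrite /e -addrA -scalerDl addrCA subrr addr0.
  have e2 : x + m *: d + e = x + t *: d.
    by rewrite /e -addrA -scalerDl; congr (x + _ *: d); rewrite /m; field.
  have Kr q : 0 <= q -> q <= 1 -> K (x + q *: d) by move=> *; apply: relaxation_convex => //; apply/andP.
  have m0 : 0 <= m by rewrite /m; lra.
  have m1 : m <= 1 by rewrite /m; lra.
  have rm : r <= m by rewrite /m; lra.
  have := @DR_relaxation (x + r *: d) (x + m *: d) e; rewrite e1 e2.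
  move=> /(_ (Kr _ r0 (le_trans rm m1)) (Kr _ m0 m1) (Kr _ m0 m1) (Kr _ (le_trans r0 rt) t1)).
  have le1 j : (x + r *: d) 0 j <= (x + m *: d) 0 j by rewrite !mxE lerD2l ler_wpM2r.
  have le2 j : 0 <= e 0 j by rewrite !mxE mulr_ge0 // subr_ge0.
  by move=> /(_ le1 le2); rewrite /h -/m; lra.
have -> : f x = h 0 by rewrite /h scale0r addr0.
have -> : f (x + d) = h 1 by rewrite /h scale1r.
case=> [[p [q [q0 sE]]]|[fx dN]].
  have qR : 0 < q%:R :> R by rewrite ltr0n.
  (* The multiples of [1 / q] in the unit interval are stable under doubling and finite in number,
     which by itself bounds [h] from below on them. *)
  pose D r := 0 <= r <= 1 /\ exists p, r = p%:R / q%:R :> R.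
  apply: (midpoint_concave_orbit (D := D) mid) => [r [] //|r [r01 [k rE]] rh|r [r01 [k rE]] rh||].
  - by split; [lra | exists (2 * k)%N; rewrite rE natrM mulrA].
  - split; first lra; exists (2 * k - q)%N.
    have qk : (q <= 2 * k)%N.
      by move: rh; rewrite rE ler_pdivlMr // -(ler_nat R) natrM; lra.
    by rewrite natrB // natrM rE; field; rewrite gt_eqF.
  - exists (- \sum_(k < q.+1) `|h (k%:R / q%:R)|) => r [/andP[r0 r1] [k rE]].
    have kq : (k < q.+1)%N by rewrite ltnS -(ler_nat R) -[leRHS]mul1r -ler_pdivrMr // -rE.
    rewrite lerNl (bigD1 (Ordinal kq)) //= -rE -[leLHS]addr0 lerD ?sumr_ge0 //.
    by rewrite -normrN ler_norm.
  - by split=> //; exists p.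
apply: (midpoint_concave_orbit (D := fun r => 0 <= r <= 1) mid) => //; try by move=> *; lra.
have [b hb] := f_bounded; exists b => r r01; apply: hb; split; last exact: relaxation_convex.
move=> i iN; rewrite !mxE dN // mulr0 addr0; case: fx => + _; exact.
Qed.

Lemma nonneg_ratio_sub1 t : 1 < t -> nonneg_ratio t -> nonneg_ratio ((t - 1) / t).
Proof.
move=> t1 [p [q [q0 tE]]]; have qR : 0 < q%:R :> R by rewrite ltr0n.
have qp : (q < p)%N by move: t1; rewrite tE ltr_pdivlMr // mul1r ltr_nat.
have p0 : (0 < p)%N by apply: leq_ltn_trans qp.
exists (p - q)%N, p; split=> //; rewrite tE natrB ?(ltnW qp) //; field.
by rewrite !pnatr_eq0 -!lt0n q0 p0.
Qed.

(* When [t > 1], the last unit of the move from [x] is compared with the move from [y]. *)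
Lemma slope_le x y d t : K x -> K y -> K (x + t *: d) -> K (y + d) ->
  (forall j, 0 <= d 0 j) -> 0 <= t -> (forall j, x 0 j <= y 0 j) ->
  (forall j, (x + t *: d) 0 j <= (y + d) 0 j) ->
  nonneg_ratio t \/ [/\ feas x, feas y & forall j, j \in N -> d 0 j = 0] ->
  t * (f (y + d) - f y) <= f (x + t *: d) - f x.
Proof.
move=> Kx Ky Kxt Kyd d0 t0 xy xyd hr.
have [t1|t1] := leP t 1.
  have : f (y + t *: d) - f y <= f (x + t *: d) - f x.
    apply: DR_relaxation => //; first by apply: relaxation_convex => //; apply/andP.
    by move=> j; rewrite mxE mulr_ge0.
  have : (1 - t) * f y + t * f (y + d) <= f (y + t *: d).
    by apply: concave_segment => //; [apply/andP | case: hr => [|[]]; [left|right]].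
  lra.
have tp : 0 < t by lra.
have s01 : 0 <= (t - 1) / t <= 1.
  by rewrite divr_ge0 ?ler_pdivrMr //=; lra.
have e1 : x + ((t - 1) / t) *: (t *: d) = x + (t - 1) *: d.
  by rewrite scalerA divfK ?gt_eqF.
have : f (y + d) - f y <= f (x + t *: d) - f (x + (t - 1) *: d).
  have -> : x + t *: d = x + (t - 1) *: d + d.
    by rewrite scalerBl scale1r addrA subrK.
  apply: DR_relaxation => //; first by rewrite -e1; apply: relaxation_convex.
    by rewrite -addrA -{2}[d]scale1r -scalerDl subrK.
  by move=> j; have := xyd j; rewrite !mxE; lra.
have : (1 - (t - 1) / t) * f x + (t - 1) / t * f (x + t *: d) <= f (x + (t - 1) *: d).
  rewrite -e1; apply: concave_segment => //.
    by move=> j; rewrite mxE mulr_ge0.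
  case: hr => [hr|[fx _ dN]]; [left|right]; first exact: nonneg_ratio_sub1.
  by split=> // j jN; rewrite mxE dN ?mulr0.
have -> : 1 - (t - 1) / t = t^-1 by field; rewrite gt_eqF.
have -> : (t - 1) / t = 1 - t^-1 by field; rewrite gt_eqF.
move=> h1 h2; have h3 : f (y + d) - f y <= t^-1 * (f (x + t *: d) - f x) by lra.
by have := ler_wpM2l t0 h3; rewrite mulrA divff ?gt_eqF // mul1r.
Qed.

End DRConcavity.

(** * The greedy permutation *)

(** Separates the construction of a permutation from the selection rule. The state [t] will be the
    ratio of the last insertion, [Inv] what holds for a prefix, and [Q] what is recorded about each
    insertion. *)
Lemma greedy_perm (v : nat) (T : Type) (Inv : {set 'I_v} -> T -> Prop)
    (Q : {set 'I_v} -> T -> 'I_v -> T -> Prop) (t0 : T) :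
  Inv finset.set0 t0 ->
  (forall S t, Inv S t -> S != [set: 'I_v]%SET -> exists i t',
     [/\ i \notin S, Q S t i t' & Inv (i |: S)%SET t']) ->
  exists (d : 'S_v) (ts : nat -> T), ts 0%N = t0 /\
    forall k : 'I_v, Q (Tset d k) (ts k) (d k) (ts k.+1).
Proof.
move=> Inv0 next.
pose ofs (s : seq 'I_v) : {set 'I_v} := [set x in s]%SET.
have in_ofs s x : (x \in ofs s) = (x \in s) by rewrite inE.
have H m : (m <= v)%N -> exists (s : seq 'I_v) (ts : nat -> T),
    [/\ uniq s, size s = m, ts 0%N = t0, Inv (ofs s) (ts m) &
      forall k x0, (k < m)%N ->
        Q (ofs (take k s)) (ts k) (nth x0 s k) (ts k.+1)].
  elim: m => [_|m IHm mv].
    exists [::], (fun=> t0); split=> //.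
  have [s [ts [us ss ts0 inv hs]]] := IHm (ltnW mv).
  have nT : ofs s != [set: 'I_v]%SET.
    apply/eqP => sT; have := card_uniqP us; rewrite ss => /eqP.
    rewrite -(eq_card (in_ofs s)) sT cardsT card_ord => /eqP e.
    by rewrite e ltnn in mv.
  have [i [t [is_ Qi inv']]] := next _ _ inv nT.
  exists (rcons s i), (fun k => if (k <= m)%N then ts k else t); split=> //.
  - by rewrite rcons_uniq us andbT; rewrite in_ofs in is_.
  - by rewrite size_rcons ss.
  - rewrite ltnn; suff -> : ofs (rcons s i) = (i |: ofs s)%SET by [].
    by apply/setP => x; rewrite !inE mem_rcons inE.
  - move=> k x0 /ltnSE klem; have /orP[/eqP ->|km] /= : (k == m) || (k < m)%N by rewrite -leq_eqVlt.
      by rewrite leqnn ltnn nth_rcons ss ltnn eqxx -cats1 take_size_cat.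
    rewrite (ltnW km) km nth_rcons ss km -cats1 takel_cat ?ss ?(ltnW km) //.
    exact: hs.
have [s [ts [us ss ts0 _ hs]]] := H v (leqnn v).
have nth_inj : injective (fun k : 'I_v => nth k s k).
  move=> k l /eqP; rewrite (set_nth_default k) ?ss // nth_uniq ?ss //.
  by move=> /eqP/val_inj.
have dE k : perm nth_inj k = nth k s k by rewrite permE.
exists (perm nth_inj), ts; split=> // k; rewrite dE.
rewrite (_ : Tset _ _ = (ofs (take k s))); first exact: hs.
apply/setP => i; rewrite in_Tset in_ofs.
have e : i = nth i s (pos (perm nth_inj) i).
  by rewrite -{1}(perm_pos (perm nth_inj) i) dE; apply: set_nth_default; rewrite ss.
have is_ : i \in s by rewrite e mem_nth ?ss ?ltn_ord.
by rewrite in_take // {2}e index_uniq ?ss ?ltn_ord.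
Qed.

(** Turns decreasing coefficients of increments into the weights [t j - t j.+1] of a convex
    combination. Vector values let it serve both for the points and for the sum of the weights. *)
Lemma abel_summation (R : pzRingType) (E : lmodType R) (t : nat -> R) (a : nat -> E) n :
  \sum_(j < n.+1) (t j - t j.+1) *: a j =
  t 0%N *: a 0%N - t n.+1 *: a n + \sum_(k < n) t k.+1 *: (a k.+1 - a k).
Proof.
elim: n => [|n IHn]; first by rewrite big_ord1 big_ord0 addr0 scalerBl.
rewrite big_ord_recr IHn [in RHS]big_ord_recr /= scalerBl scalerBr.
set A := t 0%N *: _; set B := t n.+1 *: a n; set C := \sum_(_ < _) _.
set D := t n.+1 *: a _; set F := t n.+2 *: _.
rewrite -!addrA; congr (A + _); rewrite addrCA [in RHS]addrCA; congr (C + _).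
by rewrite addrCA [in RHS]addrCA; congr (D + _); rewrite addrC.
Qed.

Lemma sum_pair (I : Type) (r : seq I) (P : pred I) (U V : nmodType)
    (a : I -> U) (b : I -> V) :
  \sum_(i <- r | P i) (a i, b i) = (\sum_(i <- r | P i) a i, \sum_(i <- r | P i) b i).
Proof. by elim/big_rec3: _ => // i x y _ _ ->. Qed.

Section Greedy.
Context (R : realType) (v : nat) (N : {set 'I_v}) (arc : rel 'I_v) (u : 'rV[R]_v).
Hypothesis adm : admissible N arc u.
Implicit Types (i j a b k psi : 'I_v) (S : {set 'I_v}).
Local Notation le := (connect arc).
Local Notation Psi := (Psi N arc u).
Local Notation fl := (ufloor u).
Local Notation ch := (ch arc).
Local Notation K := (relaxation arc u).
Local Notation forest := (adm_forest adm).
Local Notation aval := (aval N arc u).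
Local Notation anch := (anch N arc u).
Local Notation gap := (gap N arc u).
Local Notation eta := (eta arc u).

(** Clearing denominators. In this form the inequality compares numerator and denominator of the
    ratio at [psi] before anything is inserted. *)
Lemma MIR_eta psi (z : 'rV[R]_v) : psi \in Psi ->
  MIR_inequality arc u psi z <-> eta psi z <= fl psi.
Proof.
move=> pP; rewrite /MIR_inequality /eta (u_ch adm pP).
have -> : uceil u psi = fl psi + 1.
  by case: adm => _ _ _ /(_ _ pP)[_ _ <-]; rewrite (u_ch adm pP).
have h1 : 0 < u 0 psi - fl psi by rewrite subr_gt0 (fl_lt pP).
have h2 : 0 < fl psi + 1 - u 0 psi by rewrite subr_gt0 u_lt_fl1.
rewrite -(ler_pM2r h1) mulrDl !divfK ?gt_eqF // ler_pdivrMr //.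
by split; lra.
Qed.

(* Used with [y = z - t u] and [e = eta - t floor u], where [t] is the largest ratio: the inserted
   vertex has gap 0, so no anchored value changes. *)
Lemma gap_step_le0 y e S i :
  (forall psi, psi \in Psi ->
     y psi = e psi + (u 0 psi - fl psi) * (y (ch psi) - e psi)) ->
  i \notin S -> gap y e S i = 0 -> (forall j, j \notin S -> gap y e S j <= 0) ->
  forall j, j \notin (i |: S)%SET -> gap y e (i |: S)%SET j <= 0.
Proof.
move=> rel iS gi gle j; rewrite !inE negb_or => /andP[nji jS].
have anchE : anch y e (i |: S)%SET = anch y e S.
  rewrite (anch_step adm iS) ?gi ?scale0r ?addr0 // => psi pP _ <-.
  exact: rel.
have := gle j jS; rewrite /gap anchE.
have [/andP[jP /eqP cj]|ncj] := boolP ((j \in Psi) && (ch j == i)); last first.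
  rewrite /aval in_setU1; case jP: (j \in Psi) ncj => //= ncj.
  by rewrite (negbTE ncj).
have cS : ch j \notin S by rewrite cj.
have iP : i \notin Psi by rewrite -cj (ch_notPsi adm).
move: gi; rewrite /gap /aval jP cj (negbTE iP) iS in_setU1 eqxx /=.
have -> : anch y e S 0 i = anch y e S 0 j.
  rewrite !mxE -cj (triangle_above (connect_ch adm jP)) // => b bS bc.
  by apply: (connect_to_ch adm jP bc); apply: contraNneq cS => <-.
(* The new value [y j] is a convex combination of [e j], which is at most the anchored value, and of
   [y i], which equals it because the gap of [i] is 0. *)
move=> yi ej; rewrite (rel j jP) cj.
have := fl_lt jP; have := u_lt_fl1 u j; nra.
Qed.

(** Condition (1) of validity, read on a prefix of the permutation. *)
Definition closed_below S :=
  forall a j, a \in S -> le a j -> u 0 a = u 0 j -> j \in S.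

Lemma gap_u_gt0 S j : closed_below S -> j \notin S ->
  ~~ ((j \in Psi) && (ch j \notin S)) -> 0 < gap (u 0) fl S j.
Proof.
move=> cl jS jP; rewrite /gap {1}/aval (negbTE jP) mxE subr_gt0.
case t: triangle => [a|]; last exact: u_gt0 adm _.
have [aS aj _] := triangle_SomeP forest t.
rewrite /aval; case: ifPn => [/andP[aP _]|_].
  exact: lt_le_trans (fl_lt aP) (u_connect adm aj).
rewrite lt_neqAle (u_connect adm aj) andbT.
by apply: contraNneq jS; apply: cl aS aj.
Qed.

Variable z : 'rV[R]_v.
Hypothesis Kz : K z.
Local Notation gz := (gap (z 0) (eta^~ z)).
Local Notation gu := (gap (u 0) fl).

Lemma eta_le psi : psi \in Psi -> eta psi z <= z 0 psi.
Proof.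
move=> pP; have := relaxation_connect Kz (connect_ch adm pP).
have := eta_rel adm z pP; have := fl_lt pP; have := u_lt_fl1 u psi.
move=> h1 h2 h3 h4; rewrite -subr_ge0.
have -> : z 0 psi - eta psi z =
  (u 0 psi - fl psi) * (z 0 (ch psi) - z 0 psi) / (fl psi + 1 - u 0 psi).
  have h : fl psi + 1 - u 0 psi != 0 by rewrite gt_eqF // subr_gt0.
  by apply: (mulIf h); rewrite divfK //; lra.
by rewrite divr_ge0 ?mulr_ge0 // ?subr_ge0 // ltW.
Qed.

Lemma gap_z_ge0 S j : ~~ ((j \in Psi) && (ch j \notin S)) -> 0 <= gz S j.
Proof.
move=> jP; rewrite /gap {1}/aval (negbTE jP) mxE subr_ge0.
case t: triangle => [a|]; last by case: Kz => /(_ j)/andP[].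
have [aS aj _] := triangle_SomeP forest t.
apply: le_trans (relaxation_connect Kz aj).
rewrite /aval; case: ifPn => [/andP[aP _]|//]; exact: eta_le.
Qed.

Lemma greedy_step S tau : closed_below S -> S != [set: 'I_v]%SET ->
  (forall j, j \notin S -> gz S j <= tau * gu S j) ->
  exists i t, [/\ i \notin S,
    [/\ 0 <= t <= tau, 0 < gu S i, gz S i = t * gu S i & closed_below (i |: S)%SET],
    closed_below (i |: S)%SET &
    forall j, j \notin (i |: S)%SET -> gz (i |: S)%SET j <= t * gu (i |: S)%SET j].
Proof.
move=> cl nT inv.
(* The denominator at [psi] may vanish while [ch psi] is missing; the denominator at [ch psi] is
   then positive. *)
have free j : j \notin S -> exists i,
    [/\ i \notin S, ~~ ((i \in Psi) && (ch i \notin S)) & 0 < gu S i].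
  move=> jS; have [/andP[jP cS]|jP] := boolP ((j \in Psi) && (ch j \notin S)).
    have cP : ~~ ((ch j \in Psi) && (ch (ch j) \notin S)).
      by rewrite (negbTE (ch_notPsi adm jP)).
    by exists (ch j); split=> //; apply: gap_u_gt0.
  by exists j; split=> //; apply: gap_u_gt0.
have [j0 j0S] : exists j, j \notin S.
  apply/existsP; rewrite -negb_forall; apply: contra nT => /forallP h.
  by apply/eqP/setP => j; rewrite h inE.
have [i0 [i0S i0P i0g]] := free j0 j0S.
pose cand j := (j \notin S) && (0 < gu S j); pose ratio j := gz S j / gu S j.
have c0 : cand i0 by rewrite /cand i0S.
have [i1 c1 max1'] := arg_maxP ratio c0.
have max1 j : cand j -> ratio j <= ratio i1 := @max1' j.
pose cand1 j := cand j && (ratio j == ratio i1).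
have c11 : cand1 i1 by rewrite /cand1 c1 eqxx.
have [i /andP[/andP[iS gi] /eqP ri] max2] := @arg_maxnP _ i1 cand1 (depth arc) c11.
set t := ratio i1 in ri max1 *.
have gzi : gz S i = t * gu S i by rewrite -ri divfK // gt_eqF.
(* The numerator can be negative at a [psi] whose child is missing, but not at [i0], so the largest
   ratio is nonnegative. *)
have t0 : 0 <= t.
  apply: le_trans (max1 i0 c0); rewrite divr_ge0 ?gap_z_ge0 ?ltW //.
have ttau : t <= tau by rewrite -ri ler_pdivrMr // inv.
have gu0 S' j : 0 <= gu S' j by apply: gap_ge0 (anchorable_u adm) _ _.
(* Vertices with denominator 0 have no ratio; there the old bound reads [gz S j <= 0], whatever the
   factor. *)
have invt j : j \notin S -> gz S j <= t * gu S j.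
  move=> jS; have [gj|] := ltP 0 (gu S j).
    by rewrite -ler_pdivrMr //; apply: max1; rewrite /cand jS.
  move=> gj; have gj0 : gu S j = 0 by apply/eqP; rewrite eq_le gj gu0.
  by have := inv j jS; rewrite gj0 !mulr0.
(* A missing [j] below [i] with the same bound would copy the same ancestor, hence have the same
   denominator and no smaller numerator: a tie won by the deeper [j]. *)
have cl' : closed_below (i |: S)%SET.
  move=> a j; rewrite !in_setU1 => /orP[/eqP ->{a}|aS] aj eu; last first.
    by rewrite (cl a j) ?orbT.
  apply/negPn/negP; rewrite negb_or => /andP[nji jS].
  have iP : i \notin Psi.
    apply/negP => iP; have := below_Psi_ge adm iP aj nji.
    by rewrite -eu leNgt u_lt_fl1.
  have jP : j \notin Psi.
    apply/negP => jP; rewrite eq_sym in nji; have := above_Psi_le adm jP aj nji.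
    by rewrite eu leNgt (fl_lt jP).
  have tji : triangle arc S j = triangle arc S i.
    apply: (triangle_above aj) => b bS bj.
    have [//|ib] := orP (ancestors_chain forest bj aj).
    case/negP: jS; apply: (cl b j bS bj).
    by apply/eqP; rewrite eq_le (u_connect adm bj) -eu (u_connect adm ib).
  have guE : gu S j = gu S i.
    by rewrite /gap !mxE tji /aval (negbTE iP) (negbTE jP) /= eu.
  have gzle : gz S i <= gz S j.
    rewrite /gap !mxE tji lerD2r /aval (negbTE iP) (negbTE jP) /=.
    exact: relaxation_connect Kz aj.
  have cj : cand j by rewrite /cand jS guE.
  have rj : ratio j = t.
    apply/eqP; rewrite eq_le max1 //= -ri /ratio guE ler_pM2r ?invr_gt0 //.
  have ji : (depth arc j <= depth arc i)%N by apply: max2; rewrite /cand1 cj rj /t eqxx.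
  by move: ji; rewrite leqNgt (connect_depth forest aj) // eq_sym.
exists i, t; split=> //; first by rewrite t0 ttau.
move=> j jiS; pose y k := z 0 k + (- t) * u 0 k.
pose e k := eta k z + (- t) * fl k.
have gE S' k : gap y e S' k = gz S' k - t * gu S' k.
  by rewrite /y /e gap_lin mulNr.
rewrite -subr_le0 -gE; apply: gap_step_le0 => //.
- move=> psi pP; rewrite /y /e (eta_rel adm z pP) [X in _ + _ * X](floor_rel adm pP).
  by ring.
- by rewrite gE gzi subrr.
- by move=> k kS; rewrite gE subr_le0 invt.
Qed.

End Greedy.

(** * Points of the polyhedron as convex combinations *)

Section HullContainsPolyhedron.
Context (R : realType) (v : nat) (N : {set 'I_v}) (arc : rel 'I_v) (u : 'rV[R]_v).
Hypothesis adm : admissible N arc u.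
Implicit Types (i j a b psi : 'I_v) (S : {set 'I_v}).
Local Notation Psi := (Psi N arc u).
Local Notation fl := (ufloor u).
Local Notation ch := (ch arc).
Local Notation K := (relaxation arc u).
Local Notation forest := (adm_forest adm).
Local Notation anch := (anch N arc u).
Local Notation eta := (eta arc u).
Local Notation gu := (gap N arc u (u 0) fl).
Local Notation P d k := (Pvec N arc u (Tset d k)).

(** If [psi] precedes its child, a positive gap says that the anchored value at [psi] was below
    [floor u_psi]. This is impossible if that floor is 0, which gives (2), or if an ancestor with
    that bound is already inserted, which gives (3). *)
Lemma valid_perm_greedy (d : 'S_v) :
  (forall k : 'I_v, 0 < gu (Tset d k) (d k)) ->
  (forall k : 'I_v, closed_below arc u (d k |: Tset d k)%SET) ->
  valid_perm N arc u d.
Proof.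
move=> gpos cl.
have gpsi psi : psi \in Psi -> (pos d psi < pos d (ch psi))%N ->
    anch (u 0) fl (Tset d (pos d psi)) 0 psi < fl psi.
  move=> pP lt; have := gpos ((d^-1)%g psi); rewrite perm_pos -/(pos d psi).
  by rewrite /gap /aval pP in_Tset -leqNgt ltnW //= subr_gt0.
split=> [i j nij ij eu|psi pP fl0|psi i pP ip ui /andP[lt1 lt2]].
- rewrite inE in ij; have := cl ((d^-1)%g i) i j; rewrite perm_pos setU11 => /(_ isT ij eu).
  by rewrite in_setU1 in_Tset eq_sym (negbTE nij).
- rewrite ltnNge leq_eqVlt negb_or; apply/andP; split.
    by rewrite (inj_eq (@pos_inj _ d)) eq_sym (ch_neq adm pP).
  apply/negP => /(gpsi _ pP); rewrite fl0 ltNge.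
  by case: (anch_relaxation adm (anchorable_u adm) (Tset d (pos d psi))) => /(_ psi)/andP[->].
- have := gpsi _ pP lt2; rewrite inE in ip; rewrite mxE -ui ltNge => /negP; apply.
  have := triangleP forest (Tset d (pos d psi)) psi.
  case: triangle => [a [aS ap amax]|/(_ i)]; last by rewrite in_Tset lt1 ip => /(_ isT).
  rewrite /aval; have -> : a \in Psi = false.
    apply/negbTE/negP => aP; have e := Psi_antichain adm aP pP ap.
    by move: aS; rewrite e in_Tset ltnn.
  by apply: (u_connect adm); apply: amax; rewrite ?in_Tset.
Qed.

Lemma polyhedron_greedy z : K z -> (forall psi, psi \in Psi -> eta psi z <= fl psi) ->
  exists (d : 'S_v) (ts : nat -> R), [/\ valid_perm N arc u d, ts 0%N = 1,
    forall k : 'I_v, 0 <= ts k.+1 <= ts k /\ tcoef N arc u d z k = ts k.+1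
    & z = \sum_(k < v) ts k.+1 *: (P d k.+1 - P d k)].
Proof.
move=> Kz etale; set gz := gap N arc u (z 0) (eta^~ z).
have [|S t [cl inv] nT|d [ts [ts0 hQ]]] := @greedy_perm v R
  (fun S t => closed_below arc u S /\ forall j, j \notin S -> gz S j <= t * gu S j)
  (fun S t i t' => [/\ 0 <= t' <= t, 0 < gu S i, gz S i = t' * gu S i &
     closed_below arc u (i |: S)%SET]) 1.
- split=> [a j|j _]; first by rewrite inE.
  rewrite mul1r /gz /gap !anch_set0 // !mxE !subr0 /aval; case: ifPn => [/andP[jP _]|_].
    exact: etale.
  by case: Kz => /(_ j)/andP[].
- have [i [t' [iS Q cl' inv']]] := greedy_step adm Kz cl nT inv.
  by exists i, t'; split.
exists d, ts; split=> //.
- by apply: valid_perm_greedy => k; have [] := hQ k.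
- move=> k; have [-> g0 gzE _] := hQ k; split=> //.
  by rewrite (tcoef_gap adm) -/gz gzE mulfK // gt_eqF.
have step (k : 'I_v) : ts k.+1 *: (P d k.+1 - P d k) =
    anch (z 0) (eta^~ z) (Tset d k.+1) - anch (z 0) (eta^~ z) (Tset d k).
  have [_ _ gzE _] := hQ k; rewrite !Pvec_anch !TsetS.
  rewrite (anch_step (y := z 0) adm) ?Tset_perm //; last first.
    by move=> psi pP _ <-; apply: (eta_rel adm).
  rewrite (anch_step (y := u 0) adm) ?Tset_perm //; last first.
    by move=> psi pP _ <-; apply: (floor_rel adm).
  by rewrite ![_ + _ *: _]addrC !addrK scalerA -gzE.
rewrite (eq_bigr _ (fun k _ => step k)).
rewrite -(big_mkord xpredT (fun k => anch (z 0) (eta^~ z) (Tset d k.+1) -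
   anch (z 0) (eta^~ z) (Tset d k))) telescope_sumr //.
by rewrite Tset_full Tset0 (anch_row adm) (anch_set0 adm) subr0.
Qed.

Lemma polyhedron_sub_hull (f : 'rV[R]_v -> R) (f0 : f 0 = 0) z (w : R) : K z ->
  (forall psi, psi \in Psi -> MIR_inequality arc u psi z) ->
  (forall d, valid_perm N arc u d -> DR_inequality N arc u f d z w) ->
  convex_hull (epigraph N arc u f) ((z, w) : 'rV[R]_v * R^o).
Proof.
move=> Kz mir dr.
have [|d [ts [vd ts0 hts zE]]] := polyhedron_greedy Kz.
  by move=> psi pP; apply/(MIR_eta adm _ pP)/mir.
set W := \sum_(k < v) ts k.+1 * (f (P d k.+1) - f (P d k)).
have Ww : W <= w.
  have := dr d vd; rewrite /DR_inequality; congr (_ <= _).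
  by apply: eq_bigr => k _; have [_ ->] := hts k.
(* The value 0 at [v.+1] makes the weights sum to [ts 0 = 1]; the surplus [w - W] can then be added
   to the height of every point. *)
pose t k := if (k <= v)%N then ts k else 0.
pose p k : 'rV[R]_v * R^o := (P d k, f (P d k) + (w - W)).
have sumE (E : lmodType R) (a : nat -> E) :
    \sum_(j < v.+1) (t j - t j.+1) *: a j = a 0%N + \sum_(k < v) ts k.+1 *: (a k.+1 - a k).
  rewrite abel_summation /t leq0n ltnn ts0 scale1r scale0r subr0; congr (_ + _).
  by apply: eq_bigr => k _; rewrite ltn_ord.
exists v.+1, (fun j : 'I_v.+1 => t j - t j.+1), (fun j : 'I_v.+1 => p j); split.
- move=> j; have jle : (j <= v)%N := ltn_ord j.
  rewrite subr_ge0 /t jle; case: ifP => [jv|_].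
    by have [/andP[]] := hts (Ordinal jv).
  have := ltn_ord j; rewrite ltnS leq_eqVlt => /orP[/eqP jv|jv].
    (* The last weight is [ts v], which is [ts 0] when there are no vertices. *)
    rewrite jv; case: (posnP v) => [v0|v0]; first by rewrite v0 ts0.
    have pv : (v.-1 < v)%N by rewrite prednK.
    by have [/andP[+ _] _] := hts (Ordinal pv); rewrite /= prednK.
  by have [/andP[h1 h2] _] := hts (Ordinal jv); apply: le_trans h2.
- have := sumE R^o (fun=> 1); rewrite [X in _ = _ + X]big1 ?addr0; last first.
    by move=> k _; rewrite /= subrr scaler0.
  by move=> <-; apply: eq_bigr => j _; rewrite /GRing.scale /= mulr1.
- move=> j; split; first exact: Pvec_feasible.
  by rewrite /= lerDl subr_ge0.
rewrite sumE.
have -> : \sum_(k < v) ts k.+1 *: (p k.+1 - p k) = (z, W).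
  rewrite [in RHS]zE /W -sum_pair; apply: eq_bigr => k _.
  by rewrite /p; congr (_, _); rewrite /GRing.scale /=; ring.
rewrite /p Tset0 Pvec_anch (anch_set0 adm) f0 add0r.
by congr (_, _); rewrite ?add0r //= subrK.
Qed.

End HullContainsPolyhedron.

(** * Reduction to integral points *)

Section Reduction.
Context (R : realType) (v : nat) (N : {set 'I_v}) (arc : rel 'I_v) (u : 'rV[R]_v).
Hypothesis adm : admissible N arc u.
Implicit Types (i j l psi : 'I_v) (x z : 'rV[R]_v) (s : R).
Local Notation le := (connect arc).
Local Notation Psi := (Psi N arc u).
Local Notation ch := (ch arc).
Local Notation K := (relaxation arc u).
Local Notation feas := (feasible N arc u).
Local Notation forest := (adm_forest adm).

(** Non-arcs get the slack 1, so that they never count as tight. *)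
Definition slack x (c : 'I_v + 'I_v * 'I_v) : R :=
  match c with
  | inl i => u 0 i - x 0 i
  | inr (i, j) => if arc i j then x 0 j - x 0 i else 1
  end.

(** The integral coordinates and the tight constraints together: each reduction step enlarges this
    finite set, so its complement measures the recursion. *)
Definition tight x : {set 'I_v + ('I_v + 'I_v * 'I_v)} :=
  [set q | match q with
           | inl i => x 0 i \is a Num.int
           | inr c => slack x c == 0
           end]%SET.

(* The coordinates equal to [z 0 i0], except below a coordinate held at that value by its upper
   bound: this set can be moved up and down without breaking any tight constraint. *)
Definition level z i0 : {set 'I_v} :=
  [set j | (z 0 j == z 0 i0) &&
           ~~ [exists l, [&& le l j, z 0 l == u 0 l & z 0 l == z 0 i0]]]%SET.

Definition level_dir z i0 : 'rV[R]_v := \row_j (j \in level z i0)%:R.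

Section Move.
Variables (z : 'rV[R]_v) (i0 : 'I_v).
Hypothesis fz : feas z.
Hypothesis z_nint : z 0 i0 \isn't a Num.int.
Hypothesis i0_level : i0 \in level z i0.
Local Notation J := (level z i0).
Local Notation e := (level_dir z i0).

Lemma level_eq j : j \in J -> z 0 j = z 0 i0.
Proof. by rewrite inE => /andP[/eqP]. Qed.

Lemma level_notN j : j \in N -> e 0 j = 0.
Proof.
move=> jN; rewrite mxE; case jJ: (j \in J) => //.
by have := z_nint; rewrite -(level_eq jJ); case: fz => /(_ j jN) ->.
Qed.

Lemma level_lt j : j \in J -> z 0 j < u 0 j.
Proof.
move=> jJ; have zj := level_eq jJ; case: fz => _ [/(_ j)/andP[_ zu] _].
rewrite lt_neqAle zu andbT; apply/eqP => e; move: jJ; rewrite inE => /andP[_ /existsP[]].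
by exists j; rewrite connect0 -e zj !eqxx.
Qed.

(** The delicate case is a [j] at its own upper bound: then [z i = z j = u j >= u i], so [i] is at
    its bound too and both are excluded. *)
Lemma level_arc i j : arc i j -> z 0 i = z 0 j -> (i \in J) = (j \in J).
Proof.
move=> ij zij; rewrite !inE zij; case zj: (z 0 j == z 0 i0) => //=; congr (~~ _).
apply/existsP/existsP => -[l /and3P[li zu zl]].
  by exists l; rewrite zu zl (connect_trans li (connect1 ij)).
have [lj|nlj] := eqVneq l j; last first.
  by exists l; rewrite zu zl (connect_arc_inv forest li ij).
exists i; rewrite connect0 zij zj andbT /=; case: fz => _ [/(_ i)/andP[_ ziu] _].
rewrite eq_le -{1}zij ziu /= -lj (eqP zu) lj.
exact: (u_connect adm (connect1 ij)).
Qed.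

(** A ratio test as in the simplex method. All rates are 0 or [1] or [-1], and 0 on tight
    constraints, so the step length is the smallest bound among those that decrease. *)
Lemma level_move (sg : R) : sg = 1 \/ sg = -1 ->
  exists beta, [/\ 0 < beta,
    forall s, 0 <= s <= beta -> feas (z + (s * sg) *: e)
    & tight z \proper tight (z + (beta * sg) *: e)].
Proof.
move=> hsg; have [zN Kz] := fz; have [zb zm] := Kz.
(* [None] stands for the distance from [z i0] to the next integer in the direction of the move. Its
   rate is [-1], so some bound always decreases. *)
pose bound c x : R := if c is Some c' then slack x c' else
  if sg == 1 then (Num.ceil (z 0 i0))%:~R - x 0 i0 else x 0 i0 - (Num.floor (z 0 i0))%:~R.
pose rate c : R := match c with
  | None => -1
  | Some (inl i) => - sg * e 0 i
  | Some (inr (i, j)) => if arc i j then sg * (e 0 j - e 0 i) else 0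
  end.
have m1 : (-1 == 1 :> R) = false by apply/eqP; lra.
have e_i0 : e 0 i0 = 1 by rewrite mxE i0_level.
have mvE s j : (z + (s * sg) *: e) 0 j = z 0 j + s * sg * e 0 j by rewrite !mxE.
have boundE c s : bound c (z + (s * sg) *: e) = bound c z + s * rate c.
  case: c => [[i|[i j]]|] /=; rewrite !mvE; first by ring.
    by case: ifP => _; [ring | rewrite mulr0 addr0].
  by rewrite e_i0; case: hsg => ->; rewrite ?eqxx ?m1; ring.
have e01 j : e 0 j = 0 \/ e 0 j = 1 by rewrite mxE; case: (j \in J); [right|left].
have rate_cases c : [\/ rate c = 0, rate c = 1 | rate c = -1].
  case: c => [[i|[i j]]|] /=; last by constructor 3.
    by case: hsg => ->; case: (e01 i) => ->; rewrite ?mulr0 ?mulr1 ?opprK;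
      [constructor 1|constructor 3|constructor 1|constructor 2].
  case: ifP => _; last by constructor 1.
  case: hsg => ->; case: (e01 i) => ->; case: (e01 j) => ->;
    by [constructor 1; ring | constructor 2; ring | constructor 3; ring].
have bound_ge0 c : 0 <= bound c z.
  case: c => [[i|[i j]]|] /=.
  - by rewrite subr_ge0; case/andP: (zb i).
  - by case: ifP => // ij; rewrite subr_ge0 zm.
  - by case: ifP => _; rewrite subr_ge0 ?ceil_ge ?floor_le.
have rate0 c : bound c z = 0 -> rate c = 0.
  case: c => [[i|[i j]]|] /=.
  - move=> /eqP; rewrite subr_eq0 => /eqP ui; rewrite mxE.
    by case iJ: (i \in J); [have := level_lt iJ; rewrite ui ltxx | rewrite mulr0].
  - case: ifP => // ij /eqP; rewrite subr_eq0 => /eqP zij.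
    by rewrite !mxE (level_arc ij) // subrr mulr0.
  - case: ifP => _ /eqP; rewrite subr_eq0 => /eqP zE; exfalso; move: z_nint.
      by rewrite -zE intr_int.
    by rewrite zE intr_int.
have [c /eqP rc cmin] := @arg_minP _ _ _ None (fun c => rate c == -1) (bound^~ z) (eqxx _).
set beta := bound c z in cmin *.
have beta0 : 0 < beta.
  rewrite lt_neqAle bound_ge0 andbT eq_sym; apply/eqP => /rate0; rewrite rc; lra.
have bound_move s c' : 0 <= s <= beta -> 0 <= bound c' (z + (s * sg) *: e).
  move=> /andP[s0 sb]; rewrite boundE; have := bound_ge0 c'.
  case: (rate_cases c') => rc'; rewrite rc' ?mulr0 ?mulr1 ?mulrN1; try lra.
  by move=> _; rewrite subr_ge0 (le_trans sb) // cmin ?rc'.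
exists beta; split=> //.
  move=> s sb.
  split=> [i iN|]; first by rewrite mvE level_notN // mulr0 addr0 zN.
  split=> [i|i j ij].
    have := bound_move s (Some (inl i)) sb; rewrite /= subr_ge0 => ->; rewrite andbT.
    have /andP[zi _] := zb i; have [s0 _] := andP sb.
    case: hsg => sgE; first by rewrite mvE sgE addr_ge0 // mulr1 mulr_ge0 // mxE.
    rewrite mvE mxE; case iJ: (i \in J); last by rewrite mulr0 addr0.
    (* Moving down, coordinates of the level set stay above [floor (z i0)], hence nonnegative. *)
    have := bound_move s None sb; rewrite /= !mvE e_i0 sgE m1 (level_eq iJ) subr_ge0.
    apply: le_trans; rewrite ler0z real_floor_ge0 ?num_real //.
    by case/andP: (zb i0).
  by have := bound_move s (Some (inr (i, j))) sb; rewrite /= ij subr_ge0.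
rewrite properE; apply/andP; split.
  apply/fintype.subsetP => -[i|c']; rewrite !inE.
    move=> zi; rewrite !mxE; case iJ: (i \in J); last by rewrite mulr0 addr0.
    by have := z_nint; rewrite -(level_eq iJ) zi.
  move=> /eqP c0; have := boundE (Some c') beta; rewrite /= c0 add0r.
  by have /= -> := rate0 (Some c') c0; rewrite mulr0 => ->.
have new w c' : bound c' w = 0 -> 0 < bound c' z -> exists2 q, q \in tight w & q \notin tight z.
  case: c' => [c'|] /= w0 z0.
    by exists (inr c'); rewrite !inE ?w0 // gt_eqF.
  exists (inl i0); rewrite !inE //; move: w0; case: ifP => _ /eqP; rewrite subr_eq0.
    by move=> /eqP <-; exact: intr_int.
  by move=> /eqP ->; exact: intr_int.
by apply/fintype.subsetPn; apply: (new _ c) => //; rewrite boundE rc mulrN1 subrr.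
Qed.

End Move.

Definition reduced z :=
  [/\ feas z, forall i, reachN N arc i -> i \notin Psi -> z 0 i \is a Num.int
    & forall psi, psi \in Psi -> z 0 psi \is a Num.int \/ z 0 psi = u 0 psi].

Context (X : set 'rV[R]_v) (X_relaxation : K `<=` X).
Context (f : 'rV[R]_v -> R) (f_DR : DR_submodular X f).
Hypothesis f_bounded : exists b : R, forall z, feas z -> b <= f z.

(** A point that is not reduced lies between the ends of an upward and a downward move, both with
    more tight constraints. [L] is linear, and [f] is concave on the segment because its direction
    vanishes on [N]. *)
Lemma le_reduced (L : 'rV[R]_v -> R) :
  (forall c x z, L (c *: x + z) = L z + c * L x) ->
  (forall z, reduced z -> L z <= f z) -> forall z, feas z -> L z <= f z.
Proof.
move=> Llin Lred z; have [n] := ubnP #|(~: tight z)%SET|.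
elim: n z => // n IHn z /ltnSE zn fz; have [zN Kz] := fz.
have [rz|nrz] := pselect (reduced z); first exact: Lred.
have [i0 [ri z_nint ziu]] : exists i0, [/\ reachN N arc i0, z 0 i0 \isn't a Num.int &
    ~ (i0 \in Psi /\ z 0 i0 = u 0 i0)].
  apply: contrapT => none; apply: nrz; split=> // [i ri iP|psi pP].
    by apply/negPn/negP => zi; apply: none; exists i; split=> // -[iP' _]; rewrite iP' in iP.
  have [zp|zp] := boolP (z 0 psi \is a Num.int); [by left|right].
  apply: contrapT => zu; apply: none; exists psi; split=> //; first by apply: Psi_reachN pP.
  by case.
have i0_level : i0 \in level z i0.
  (* A vertex [l] above [i0] and at its bound would be in [Psi]; then [z (ch l)] lies between the
     equal values at [l] and [i0], yet it is an integer. *)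
  rewrite inE eqxx /=; apply/existsP => -[l /and3P[li /eqP zu /eqP zl]].
  have lP : l \in Psi.
    by rewrite PsiE (reachN_connect li ri) andbT -zu zl.
  have [eli|nli] := eqVneq l i0; first by apply: ziu; rewrite -eli.
  have ci : le (ch l) i0 by apply: (connect_Psi adm); rewrite // eq_sym.
  have h1 := relaxation_connect Kz (connect_ch adm lP).
  have h2 := relaxation_connect Kz ci.
  have e : z 0 (ch l) = z 0 i0 by apply/eqP; rewrite eq_le h2 -zl h1.
  by move: z_nint; rewrite -e zN // (ch_N adm).
have [b [b0 fb tb]] := level_move fz z_nint i0_level (or_introl erefl).
have [a [a0 fa ta]] := level_move fz z_nint i0_level (or_intror erefl).
set e := level_dir z i0 in fb tb fa ta.
have bb : 0 <= b <= b by rewrite lexx ltW.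
have aa : 0 <= a <= a by rewrite lexx ltW.
have step w : feas w -> tight z \proper tight w -> L w <= f w.
  move=> fw tw; apply: IHn => //; apply: leq_trans zn.
  by apply: proper_card; rewrite properE !finset.setCS -properE.
pose x := z + (a * -1) *: e; pose d := (a + b) *: e; pose s := a / (a + b).
have ab : a + b != 0 by rewrite gt_eqF // addr_gt0.
have xd : x + d = z + (b * 1) *: e.
  by rewrite /x /d -addrA -scalerDl; congr (z + _ *: e); ring.
have zE : z = x + s *: d.
  by rewrite /x /d scalerA /s divfK // -addrA -scalerDl mulrN1 addNr scale0r addr0.
have s01 : 0 <= s <= 1.
  apply/andP; split; first by apply: divr_ge0; rewrite ?addr_ge0 // ltW.
  by rewrite /s ler_pdivrMr ?addr_gt0 // mul1r lerDl ltW.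
have Lx := step x (fa a aa) ta; have Ly := step _ (fb b bb) tb.
have : (1 - s) * f x + s * f (x + d) <= f (x + s *: d).
  apply: (concave_segment adm X_relaxation f_DR f_bounded) => //.
  - by case: (fa a aa).
  - by rewrite xd; case: (fb b bb).
  - by move=> j; rewrite !mxE; apply: mulr_ge0 => //; apply: addr_ge0; apply: ltW.
  - right; split=> [|j jN]; first exact: fa.
    by rewrite mxE (level_notN fz z_nint) // mulr0.
rewrite -zE; apply: le_trans.
have -> : L z = (1 - s) * L x + s * L (x + d).
  have h := Llin s d x; rewrite addrC -zE in h; have h' := Llin 1 d x.
  by rewrite scale1r addrC in h'; rewrite h h'; ring.
rewrite xd; move: s01 => /andP[s0 s1].
by apply: lerD; apply: ler_wpM2l => //; rewrite subr_ge0.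
Qed.

End Reduction.

(** * Validity of the DR inequalities *)

Section ValidPermutation.
Context (R : realType) (v : nat) (N : {set 'I_v}) (arc : rel 'I_v) (u : 'rV[R]_v).
Hypothesis adm : admissible N arc u.
Context (d : 'S_v).
Hypothesis vd : valid_perm N arc u d.
Implicit Types (i j a b psi : 'I_v) (S A : {set 'I_v}).
Local Notation Psi := (Psi N arc u).
Local Notation fl := (ufloor u).
Local Notation ch := (ch arc).
Local Notation forest := (adm_forest adm).
Local Notation T k := (Tset d k).
Local Notation P k := (Pvec N arc u (Tset d k)).
Local Notation gu k := (gap N arc u (u 0) fl (Tset d k) (d k)).

Lemma valid_closed_below k : closed_below arc u (T k).
Proof.
case: vd => v1 _ _ a j; rewrite !in_Tset => ak aj eu.
have [<-//|naj] := eqVneq a j.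
by apply: ltn_trans (v1 a j naj _ eu) ak; rewrite inE.
Qed.

(** Each condition of validity excludes one way for a denominator to vanish: (1) for vertices valued
    at [u]; for a [psi] preceding its child, (2) if nothing above it is inserted and (3)
    otherwise. *)
Lemma valid_gap_gt0 (k : 'I_v) : 0 < gu k.
Proof.
have [/andP[iP cT]|iP] := boolP ((d k \in Psi) && (ch (d k) \notin T k)); last first.
  by apply: (gap_u_gt0 adm) iP; [apply: valid_closed_below | apply: Tset_perm].
rewrite lt_neqAle (gap_ge0 adm (anchorable_u adm)) andbT eq_sym /gap subr_eq0.
have lt : (pos d (d k) < pos d (ch (d k)))%N.
  rewrite ltn_neqAle (inj_eq (@pos_inj _ d)) eq_sym (ch_neq adm iP) /=.
  by rewrite pos_perm leqNgt -in_Tset.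
rewrite /aval iP cT /= mxE; case: vd => _ v2 v3; apply/eqP.
case t: triangle => [a|] e; last first.
  by have := v2 _ iP e; rewrite ltnNge ltnW.
have [aT ai _] := triangle_SomeP forest t.
have nai : a != d k by apply: contraTneq aT => ->; apply: Tset_perm.
move: e; rewrite /aval (negbTE (above_Psi_notPsi adm iP ai nai)) /= => e.
apply: (v3 _ a iP); rewrite ?inE //.
by rewrite lt andbT pos_perm -in_Tset.
Qed.

Lemma Pvec_step (k : 'I_v) : P k.+1 = P k + gu k *: stepdir N arc u (T k) (d k).
Proof.
rewrite !Pvec_anch TsetS; apply: (anch_step adm); first exact: Tset_perm.
by move=> psi pP _ <-; apply: (floor_rel adm).
Qed.

Lemma stepdir_ge0 S i j : 0 <= stepdir N arc u S i 0 j.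
Proof.
rewrite mxE; case: ifP => // _; case: ifP => // /andP[jP _].
by rewrite subr_ge0 ltW // (fl_lt jP).
Qed.

Lemma Pvec_mono k l j : (k <= l <= v)%N -> P k 0 j <= P l 0 j.
Proof.
move=> /andP[/subnKC <-]; elim: (l - k)%N => [|m IHm]; first by rewrite addn0.
rewrite addnS => lt; apply: le_trans (IHm (ltnW lt)) _.
have := Pvec_step (Ordinal lt); rewrite /= => ->; rewrite [leRHS]mxE lerDl mxE.
by rewrite mulr_ge0 ?stepdir_ge0 // ltW // (valid_gap_gt0 (Ordinal lt)).
Qed.

End ValidPermutation.

(** * The effect of [eta_psi] at one fractional vertex *)

Section FractionalVertex.
Context (R : realType) (v : nat) (N : {set 'I_v}) (arc : rel 'I_v) (u : 'rV[R]_v).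
Hypothesis adm : admissible N arc u.
Hypothesis u_below : forall psi i, psi \in Psi N arc u ->
  1 < u 0 psi -> i \in Rplus arc psi -> i != psi -> u 0 i = uceil u psi.
Context (X : set 'rV[R]_v) (X_relaxation : relaxation arc u `<=` X).
Context (f : 'rV[R]_v -> R) (f_DR : DR_submodular X f).
Hypothesis f_bounded : exists b : R, forall z, feasible N arc u z -> b <= f z.
Context (d : 'S_v).
Hypothesis vd : valid_perm N arc u d.
Context (psi : 'I_v).
Hypothesis pP : psi \in Psi N arc u.
Implicit Types (i j a b : 'I_v) (S A : {set 'I_v}) (s : R).
Local Notation le := (connect arc).
Local Notation Psi := (Psi N arc u).
Local Notation K := (relaxation arc u).
Local Notation feas := (feasible N arc u).
Local Notation forest := (adm_forest adm).
Local Notation T k := (Tset d k).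
Local Notation P k := (Pvec N arc u (Tset d k)).
Local Notation gu k := (gap N arc u (u 0) (ufloor u) (Tset d k) (d k)).
Local Notation c := (ch arc psi).
Local Notation F := (ufloor u psi).
Local Notation r := (u 0 psi - F).
Local Notation e_ i := (delta_mx 0 i : 'rV[R]_v).

(** Placed in the slot of [e] with [y = 0], it gives the variation of gaps and anchored points under
    a unit change of [eta_psi]. *)
Definition floor_ind i : R := (i == psi)%:R.

(** Meant for the insertion of [ch psi] after [psi]: the share of the increment due to [psi] rising
    from [floor u_psi] to [u_psi]. *)
Definition frac_jump k : R := f (P k.+1) - f (P k.+1 - r *: e_ psi).

Lemma aval_floor_ind S i :
  aval N arc u (fun=> 0) floor_ind S i = ((i == psi) && (c \notin S))%:R.
Proof.
rewrite /aval /floor_ind; have [->|ni] /= := eqVneq i psi; last by case: ifP.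
by rewrite pP; case: (c \in S).
Qed.

Lemma anch_floor_ind S i : anch N arc u (fun=> 0) floor_ind S 0 i =
  ((triangle arc S i == Some psi) && (c \notin S))%:R.
Proof. by rewrite mxE; case: triangle => [a|//]; rewrite aval_floor_ind. Qed.

(** * A fractional vertex inserted before its child *)

Section FloorFirst.
Hypothesis lt_pos : (pos d psi < pos d c)%N.
Local Notation kp := (pos d psi).
Local Notation kc := (pos d c).
Local Notation D := [set j | le c j]%SET.
Local Notation S0 := (Tset d kp.+1).

Lemma floor_ge1 : 1 <= F.
Proof.
have [_ v2 _] := vd; have F0 := fl_ge0 adm psi.
have := int_ltD1 (int_num0 R) (fl_int u psi); rewrite add0r; apply.
rewrite lt_neqAle F0 andbT eq_sym; apply/eqP => e.
by have := v2 _ pP e; rewrite ltnNge ltnW.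
Qed.

(** Here the assumption on the bounds below [psi] enters; [floor_ge1], a consequence of condition
    (2), provides [1 < u_psi]. *)
Lemma u_D j : j \in D -> u 0 j = F + 1.
Proof.
rewrite inE => cj; have pj := connect_trans (connect_ch adm pP) cj.
have nj : j != psi by apply: contraTneq cj => ->; apply: (ch_nconnect adm pP).
rewrite (u_below pP) ?inE //; last exact: le_lt_trans floor_ge1 (fl_lt pP).
by rewrite /uceil real_ceil_floor ?num_real // (Psi_nint pP) intrD.
Qed.

Lemma D_connect i j : i \in D -> le i j -> j \in D.
Proof. by rewrite !inE; apply: connect_trans. Qed.

Lemma D_psi i : i \in D -> le psi i.
Proof. by rewrite inE; apply: (connect_trans (connect_ch adm pP)). Qed.

Lemma psi_notD : psi \notin D.
Proof. by rewrite inE (ch_nconnect adm pP). Qed.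

Lemma c_D : c \in D.
Proof. by rewrite inE connect0. Qed.

Lemma below_psi i : le psi i -> i != psi -> i \in D.
Proof. by move=> pi ni; rewrite inE (connect_Psi adm pP). Qed.

Lemma D_notPsi i : i \in D -> i \notin Psi.
Proof.
move=> iD; apply: (below_Psi_notPsi adm pP) (D_psi iD) _.
by apply: contraTneq iD => ->; apply: psi_notD.
Qed.

Lemma D_parent i j : j \in D -> arc i j -> i \notin D -> i = psi /\ j = c.
Proof.
rewrite !inE => cj ij ci; have [jc|njc] := eqVneq c j.
  by split=> //; apply: (parent_uniq forest ij); rewrite -jc; apply: (arc_ch adm pP).
by move: ci; rewrite (connect_arc_inv forest cj ij njc).
Qed.

(** With equal bounds, condition (1) inserts [D] from the leaves upwards, so that [ch psi] comes
    last in [D]. *)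
Lemma D_closed k i j : i \in D -> i \in T k -> le i j -> j \in T k.
Proof.
move=> iD iT ij; apply: (valid_closed_below vd iT ij).
by rewrite !u_D //; apply: D_connect ij.
Qed.

Lemma D_last k j : j \in D -> (kc < k)%N -> j \in T k.
Proof.
by move=> jD kk; apply: (@D_closed k c); rewrite ?c_D ?in_Tset //; rewrite inE in jD.
Qed.

Lemma Pvec_pending k i : (kp < k <= kc)%N ->
  [/\ i \in D -> i \in T k -> P k 0 i = F + 1,
      i \in D -> i \notin T k -> triangle arc (T k) i = Some psi /\ P k 0 i = F
    & P k 0 psi = F].
Proof.
move=> /andP[k1 k2]; have pT : psi \in T k by rewrite in_Tset.
have cT : c \notin T k by rewrite in_Tset -leqNgt.
split=> [iD iT|iD iT|].
- by rewrite mxE (triangle_self forest iT) (negbTE (D_notPsi iD)) u_D.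
- have tE : triangle arc (T k) i = Some psi.
    apply: (triangle_Some forest) => // [|b bT bi]; first exact: D_psi.
    have [//|pb] := orP (ancestors_chain forest bi (D_psi iD)).
    have [->|nb] := eqVneq b psi; first exact: connect0.
    by case/negP: iT; apply: D_closed bT bi; apply: below_psi.
  by split=> //; rewrite mxE tE pP cT.
- by rewrite mxE (triangle_self forest pT) pP cT.
Qed.

Lemma Pvec_psi_int : P kp 0 psi \is a Num.int.
Proof.
rewrite mxE; case t: triangle => [a|]; last exact: int_num0.
have [aT ap _] := triangle_SomeP forest t.
have na : a != psi by apply: contraTneq aT => ->; rewrite in_Tset ltnn.
by rewrite (negbTE (above_Psi_notPsi adm pP ap na)) (above_Psi_int adm pP).
Qed.

(** Just before its insertion [psi] has an integral value, smaller than [F] because its gap is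
    positive, and it dominates its ancestors. This is the room for lowering [psi] to [F - 1]. *)
Lemma above_psi_le i : le i psi -> i != psi -> P kp.+1 0 i <= F - 1.
Proof.
move=> ip ni; set k := (d^-1)%g psi; have kE : k = kp :> nat by [].
have dk : d k = psi by apply: perm_pos.
have cT : c \notin T k by rewrite in_Tset -leqNgt ltnW.
have g0 := valid_gap_gt0 adm vd k; move: g0.
rewrite /gap dk /aval pP cT /= subr_gt0 -/(anch N arc u (u 0) (ufloor u) (T k)).
rewrite -Pvec_anch => lt.
have -> : P kp.+1 0 i = P kp 0 i.
  have pT : psi \notin T k by rewrite in_Tset ltnn.
  rewrite -kE TsetS dk !Pvec_anch (anch_step adm pT); last first.
    by move=> b bP _ <-; apply: (floor_rel adm).
  rewrite mxE [X in _ + X]mxE.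
  suff -> : stepdir N arc u (T k) psi 0 i = 0 by rewrite mulr0 addr0.
  rewrite mxE; case: ifP => [/eqP t|_]; last case: ifP => // /and3P[iP _ /eqP ci].
    have [_ pi _] := triangle_SomeP forest t.
    by case/eqP: ni; apply: (connect_anti forest ip pi).
  by have := ch_notPsi adm iP; rewrite ci pP.
have [_ Km] := Pvec_relaxation adm (T kp).
have Pi : P kp 0 i <= P kp 0 psi.
  by apply: (relaxation_connect (Pvec_relaxation adm (T kp))).
apply: le_trans Pi _.
suff : P kp 0 psi + 1 <= F by lra.
by apply: int_ltD1 => //; [apply: Pvec_psi_int | apply: fl_int].
Qed.

(* P(S0 :|: A), with the value [F] on [D :\: A] and at [psi] replaced by [s] and [s'].  The base
   set is frozen at the insertion of [psi] because ancestors of [psi] inserted later may take the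
   value [F], and then [psi] could not be lowered to [F - 1]. *)
Definition pt A s s' : 'rV[R]_v :=
  \row_i (if i \in D then (if i \in A then F + 1 else s)
          else if i == psi then s' else P kp.+1 0 i).

Lemma ptE A s s' i : pt A s s' 0 i =
  if i \in D then (if i \in A then F + 1 else s) else if i == psi then s' else P kp.+1 0 i.
Proof. by rewrite mxE. Qed.

Lemma pt_relaxation A s s' : (forall i j, i \in D -> i \in A -> arc i j -> j \in A) ->
  F - 1 <= s' -> (c \in A \/ s' <= s) -> 0 <= s -> s <= F + 1 -> s' <= u 0 psi ->
  K (pt A s s').
Proof.
move=> Acl s'F s's s0 sF s'u; have [Kb Km] := Pvec_relaxation adm S0.
have F1 := floor_ge1; have lt1 := u_lt_fl1 u psi.
split=> [i|i j ij]; rewrite !ptE.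
  case: ifPn => iD; first by rewrite u_D //; case: ifP => _; apply/andP; split; lra.
  by case: eqVneq => [->|_]; [apply/andP; split; lra | apply: Kb].
have [iD|iD] := boolP (i \in D).
  rewrite (D_connect iD (connect1 ij)).
  have := Acl i j iD; case: (i \in A) => [/(_ isT ij) -> //|_].
  by case: ifP.
have [jD|jD] := boolP (j \in D).
  have [-> jc] := D_parent jD ij iD; rewrite eqxx jc.
  by case: ifP s's => [_ _|_ []//]; lra.
have [jp|njp] := eqVneq j psi.
  have nip : i != psi.
    apply: contraTneq ij => ->; rewrite jp; apply/negP => /(depth_arc forest)/eqP.
    by rewrite -[X in X == _]addn0 -addn1 eqn_add2l.
  rewrite (negbTE nip); apply: le_trans s'F; apply: above_psi_le => //.
  by rewrite -jp connect1.
have [ip|nip] := eqVneq i psi; last exact: Km.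
by have := arc_Psi adm pP; rewrite ip in ij => /(_ j ij) jc; rewrite jc c_D in jD.
Qed.

Lemma stepdir_D j (k : 'I_v) : (kp < k)%N -> d k = j -> j \in D ->
  stepdir N arc u (T k) j = e_ j + (if j == c then r else 0) *: e_ psi.
Proof.
move=> kpk dk jD; apply/rowP => i; rewrite !mxE eqxx /= .
have jT : j \notin T k by rewrite -dk Tset_perm.
have psiT : psi \in T k by rewrite in_Tset.
have njp : j != psi by apply: contraTneq jD => ->; apply: psi_notD.
have -> : (triangle arc (j |: T k)%SET i == Some j) = (i == j).
  apply/eqP/eqP => [t|->]; last by apply: (triangle_self forest); rewrite setU11.
  have [_ ji _] := triangle_SomeP forest t.
  have iT : i \in (j |: T k)%SET.
    by rewrite -dk -TsetS; apply: (@D_closed _ j) => //; rewrite -dk TsetS setU11.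
  by move: t; rewrite (triangle_self forest iT) => -[].
have [->|nij] := eqVneq i j; first by rewrite (negbTE njp) mulr0 addr0.
have -> : [&& i \in Psi, i \in T k & ch arc i == j] = (i == psi) && (j == c).
  apply/and3P/andP => [[iP iT /eqP ci]|[/eqP -> /eqP ->]]; last by rewrite pP psiT eqxx.
  have ij : le i j by rewrite -ci; apply: (connect_ch adm iP).
  have ip : i = psi.
    have [h|h] := orP (ancestors_chain forest ij (D_psi jD)); first exact: (Psi_antichain adm iP pP).
    by rewrite (Psi_antichain adm pP iP h).
  by rewrite ip eqxx -ci ip.
rewrite add0r; have [->|_] /= := eqVneq i psi; last by rewrite mulr0.
by case: ifP; rewrite mulr1.
Qed.

Lemma gu_D (k : 'I_v) : (kp < k <= kc)%N -> d k \in D -> gu k = 1.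
Proof.
move=> hk kD; have [_ h2 _] := Pvec_pending (d k) hk.
have [_ PE] := h2 kD (Tset_perm d k).
rewrite /gap -Pvec_anch PE /aval (negbTE (D_notPsi kD)) /= u_D //.
by ring.
Qed.

Lemma Pvec_stepD (k : 'I_v) : (kp < k <= kc)%N -> d k \in D ->
  P k.+1 = P k + e_ (d k) + (if d k == c then r else 0) *: e_ psi.
Proof.
move=> hk kD; have /andP[k1 _] := hk.
by rewrite (Pvec_step adm) gu_D // scale1r (stepdir_D k1) // addrA.
Qed.

Lemma pt_first : P kp.+1 = pt (T kp.+1) F F.
Proof.
apply/rowP => i; rewrite ptE.
have hk : (kp < kp.+1 <= kc)%N by rewrite ltnSn.
have [h1 h2 h3] := Pvec_pending i hk.
case: ifPn => iD; last by case: eqVneq => [->|].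
by case: ifPn => iT; [apply: h1 | case: (h2 iD iT)].
Qed.

Lemma pt_le (k : nat) i : (kp < k <= kc)%N -> pt (T k) F F 0 i <= P k 0 i.
Proof.
move=> hk; have [h1 h2 h3] := Pvec_pending i hk; rewrite ptE.
case: ifPn => iD; first by case: ifPn => iT; [rewrite h1 | case: (h2 iD iT) => _ ->].
case: eqVneq => [->|_]; first by rewrite h3.
apply: (Pvec_mono adm vd); have /andP[-> k2] := hk.
by apply: leq_trans k2 (ltnW (ltn_ord _)).
Qed.

Lemma D_Tset_arc k i j : i \in D -> i \in T k -> arc i j -> j \in T k.
Proof. by move=> iD iT /connect1; apply: D_closed iT. Qed.

Lemma add_delta (x : 'rV[R]_v) j i : (x + e_ j) 0 i = x 0 i + (i == j)%:R.
Proof. by rewrite mxE [X in _ + X]mxE eqxx. Qed.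

Lemma add_scale_delta (x : 'rV[R]_v) s j i : (x + s *: e_ j) 0 i = x 0 i + s * (i == j)%:R.
Proof. by rewrite mxE [X in _ + X]mxE [X in _ * X]mxE eqxx. Qed.

Lemma delta_ge0 j i : 0 <= (e_ j) 0 i.
Proof. by rewrite mxE ler0n. Qed.

(** The gain of the last unit move of [psi] and of the part of [D] outside [A], the coordinates that
    depend on [eta_psi]. It is a potential: the insertion of [psi] pays for it, each insertion in
    [D] consumes some of it, and [ch psi] takes the rest. *)
Definition bonus A : R := f (pt A F F) - f (pt A (F - 1) (F - 1)).

Lemma frac_gt0 : 0 < r. Proof. by rewrite subr_gt0 (fl_lt pP). Qed.

Lemma frac_lt1 : r < 1. Proof. by have := u_lt_fl1 u psi; lra. Qed.

Lemma pt_Tset_relaxation k s s' : F - 1 <= s' -> s' <= s -> s <= F -> K (pt (T k) s s').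
Proof.
move=> h1 h2 h3; have F1 := floor_ge1; have r0 := frac_gt0.
by apply: pt_relaxation; [move=> i j; apply: D_Tset_arc | | right | | |]; lra.
Qed.

(** The move behind [bonus (T k)] is split after raising [j] alone. The first part dominates the
    increment of P(d, .); the second, started two units higher at [j], is the move behind
    [bonus (T k.+1)]. *)
Lemma bonus_step (k : 'I_v) : (kp < k < kc)%N -> d k \in D ->
  f (P k.+1) - f (P k) <= bonus (T k) - bonus (T k.+1).
Proof.
have F1 := floor_ge1; move=> /andP[k1 k2] jD; set j := d k in jD *.
have hk : (kp < k <= kc)%N by rewrite k1 ltnW.
have jT : j \notin T k := Tset_perm d k.
have jc : (j == c) = false.
  by apply/negP => /eqP e; move: k2; rewrite -e pos_perm ltnn.
have jp : (j == psi) = false by apply/negP => /eqP e; move: jD; rewrite e (negbTE psi_notD).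
have PS : P k.+1 = P k + e_ j by rewrite (Pvec_stepD hk) // jc scale0r addr0.
have inT i : (i \in T k.+1) = (i == j) || (i \in T k) by rewrite TsetS in_setU1.
set x1 := pt (T k) (F - 1) (F - 1); set y1 := pt (T k.+1) (F - 1) (F - 1).
have Kx1 : K x1 by apply: pt_Tset_relaxation; lra.
have Ky1 : K y1 by apply: pt_Tset_relaxation; lra.
have y1E : y1 = x1 + e_ j + e_ j.
  apply/rowP => i; rewrite !add_delta !ptE inT.
  have [->|nij] /= := eqVneq i j; first by rewrite jD (negbTE jT); ring.
  by rewrite !addr0.
have Km : K (x1 + e_ j).
  rewrite (_ : x1 + e_ j = x1 + (1 / 2) *: (e_ j + e_ j)); last first.
    by rewrite -[e_ j]scale1r -!scalerDl scalerA; congr (_ + _ *: _); field.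
  apply: (relaxation_convex Kx1); first by rewrite addrA -y1E.
  by apply/andP; split; lra.
pose g := pt (T k) F F - (x1 + e_ j).
have gE : x1 + e_ j + g = pt (T k) F F by rewrite addrC subrK.
have gE' : y1 + g = pt (T k.+1) F F.
  apply/rowP => i; rewrite mxE /g [X in _ + X]mxE [X in _ + (_ + X)]mxE add_delta !ptE inT.
  have [->|nij] /= := eqVneq i j; first by rewrite jD (negbTE jT); ring.
  by case: ifP => _; [case: ifP => _|case: ifP => _]; ring.
have h1 : f (y1 + g) - f y1 <= f (x1 + e_ j + g) - f (x1 + e_ j).
  apply: (DR_relaxation adm X_relaxation f_DR) => //.
  - by rewrite gE; apply: pt_Tset_relaxation; lra.
  - by rewrite gE'; apply: pt_Tset_relaxation; lra.
  - by move=> i; rewrite y1E [leRHS]add_delta lerDl ler0n.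
  - move=> i; rewrite /g mxE [X in _ + X]mxE add_delta !ptE.
    have [->|nij] /= := eqVneq i j; first by rewrite jD (negbTE jT); lra.
    by case: ifP => _; [case: ifP => _|case: ifP => _]; lra.
have h2 : f (P k + e_ j) - f (P k) <= f (x1 + e_ j) - f x1.
  apply: (DR_relaxation adm X_relaxation f_DR) => //.
  - exact: (Pvec_relaxation adm).
  - by rewrite -PS; apply: (Pvec_relaxation adm).
  - move=> i; apply: le_trans (pt_le i hk); rewrite !ptE.
    by case: ifP => _; [case: ifP => _|case: ifP => _]; lra.
  - exact: delta_ge0.
by move: h1 h2; rewrite gE gE' -PS /bonus -/x1 -/y1; lra.
Qed.

(** The insertion of [psi] repeats an integral number [gu k >= 1] of times the unit move behind the
    bonus. By concavity the last repetition gains at most the average. *)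
Lemma bonus_first (k : 'I_v) : k = kp :> nat ->
  bonus (T k.+1) <= (f (P k.+1) - f (P k)) / gu k.
Proof.
move=> kE; have dk : d k = psi by rewrite -(perm_pos d psi); congr (d _); apply/val_inj.
have g0 := valid_gap_gt0 adm vd k.
have cT : c \notin T k by rewrite in_Tset -leqNgt kE ltnW.
have gE : gu k = F - P k 0 psi by rewrite /gap dk /aval pP cT -Pvec_anch.
have gi : gu k \is a Num.int by rewrite gE rpredB ?fl_int // kE Pvec_psi_int.
have g1 : 1 <= gu k by rewrite -[leLHS]add0r int_ltD1 ?int_num0.
set g := gu k in g0 gE gi g1 *; set w := stepdir N arc u (T k) (d k).
have PS : P k.+1 = P k + g *: w by rewrite (Pvec_step adm).
have ptw : pt (T k.+1) (F - 1) (F - 1) = P k.+1 - w.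
  rewrite kE pt_first -kE; apply/rowP => i; rewrite [RHS]mxE [X in _ = _ + X]mxE [X in _ = _ - X]mxE !ptE dk.
  have -> : (psi |: T k)%SET = T k.+1 by rewrite TsetS dk.
  have hk : (kp < k.+1 <= kc)%N by rewrite kE ltnSn.
  have [h1 h2 h3] := Pvec_pending i hk.
  case: ifPn => iD.
    case: ifPn => iT; last by case: (h2 iD iT) => -> _; rewrite eqxx.
    rewrite (triangle_self forest iT) (negbTE (D_notPsi iD)) /=.
    by case: eqP => [[e]|_]; [move: iD; rewrite e (negbTE psi_notD) | rewrite subr0].
  have [->|nip] := eqVneq i psi.
    by rewrite (triangle_self forest) ?eqxx // in_Tset kE.
  case: eqP => [t|_].
    have [_ pi _] := triangle_SomeP forest t.
    by move: iD; rewrite (below_psi pi nip).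
  case: ifP => [/and3P[iP _ /eqP ci]|_]; last by rewrite subr0.
  by have := ch_notPsi adm iP; rewrite ci pP.
pose s := (g - 1) / g.
have sw : P k + s *: (g *: w) = P k.+1 - w.
  by rewrite PS scalerA /s divfK ?gt_eqF // scalerBl scale1r addrA.
have : (1 - s) * f (P k) + s * f (P k + g *: w) <= f (P k + s *: (g *: w)).
  apply: (concave_segment adm X_relaxation f_DR f_bounded).
  - exact: (Pvec_relaxation adm).
  - by rewrite -PS; apply: (Pvec_relaxation adm).
  - by move=> i; rewrite mxE; apply: mulr_ge0; [apply: ltW | apply: stepdir_ge0].
  - by apply/andP; split; [apply: divr_ge0; lra | rewrite ler_pdivrMr //; lra].
  - by left; apply: int_nonneg_ratio => //; [rewrite rpredB // int_num1 | lra].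
rewrite /bonus sw -ptw -PS kE -pt_first.
have -> : 1 - s = g^-1 by rewrite /s; field; rewrite gt_eqF.
have -> : s = 1 - g^-1 by rewrite /s; field; rewrite gt_eqF.
rewrite [_ / g]mulrC; lra.
Qed.

Lemma Pvec_last (k : 'I_v) : k = kc :> nat ->
  d k = c /\ P k.+1 = P k + e_ c + r *: e_ psi.
Proof.
move=> kE; have dk : d k = c by rewrite -(perm_pos d c); congr (d _); apply/val_inj.
have hk : (kp < k <= kc)%N by rewrite kE lt_pos leqnn.
by split=> //; rewrite (Pvec_stepD hk) dk ?c_D // eqxx.
Qed.

(** Only the part in [D] of the step to [P k.+1] is performed, and [D] is closed under arcs. *)
Lemma last_relaxation (k : 'I_v) : k = kc :> nat -> K (P k + e_ c).
Proof.
move=> kE; have [dk PS] := Pvec_last kE; have r_gt0 := frac_gt0.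
have -> : P k + e_ c = P k + mask_row D (e_ c + r *: e_ psi).
  apply/rowP => i; rewrite add_delta [RHS]mxE [X in _ = _ + X]mxE add_scale_delta [(e_ c) 0 i]mxE eqxx /=.
  congr (_ + _); case: ifPn => iD; last first.
    by case: eqP => // ic; move: iD; rewrite ic c_D.
  by case: (i =P psi) => [ip|_]; [move: iD; rewrite ip (negbTE psi_notD) | rewrite mulr0 addr0].
apply: mask_row_relaxation.
- by move=> i j iD /connect1; apply: D_connect.
- by move=> i; rewrite add_scale_delta addr_ge0 ?delta_ge0 // mulr_ge0 // ltW.
- exact: (Pvec_relaxation adm).
- by rewrite addrA -PS; apply: (Pvec_relaxation adm).
Qed.

(** Now [ch psi] is the only missing vertex of [D], so the bonus raises [ch psi] and then [psi] by
    1. The first move dominates the same move at [P k]. For the second, concavity along [psi]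
    compares the slope on [[F - 1, F]] with that on [[F, F + r]], which is at least
    [frac_jump k / r]; [r] may be irrational since [psi] is not in [N]. *)
Lemma bonus_last (k : 'I_v) : k = kc :> nat ->
  f (P k.+1 - r *: e_ psi) - f (P k) + frac_jump k / r <= bonus (T k).
Proof.
have F1 := floor_ge1; have r_gt0 := frac_gt0; have r_lt1 := frac_lt1.
move=> kE; have [dk PS] := Pvec_last kE.
have hk : (kp < k <= kc)%N by rewrite kE lt_pos leqnn.
have cT : c \notin T k by rewrite in_Tset kE ltnn.
have PS' : P k.+1 - r *: e_ psi = P k + e_ c by rewrite PS addrK.
have inT i : (i \in T k.+1) = (i == c) || (i \in T k) by rewrite TsetS dk in_setU1.
have DT i : i \in D -> i \in T k.+1 by move=> iD; apply: D_last; rewrite ?kE.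
have KPc := last_relaxation kE.
pose x1 := pt (T k) (F - 1) (F - 1); pose x2 := pt (T k) F (F - 1).
pose y2 := pt (T k.+1) F (F - 1); pose y3 := pt (T k.+1) F F.
have x2E : x1 + e_ c = x2.
  apply/rowP => i; rewrite add_delta !ptE; case: ifPn => iD.
    have := DT i iD; rewrite inT; case: eqVneq => [->|_] /=; last by move=> ->; rewrite addr0.
    by rewrite (negbTE cT) => _; ring.
  by case: (i =P c) => [ic|_]; [move: iD; rewrite ic c_D | rewrite addr0].
have x3E : x2 + e_ psi = pt (T k) F F.
  apply/rowP => i; rewrite add_delta !ptE; case: ifPn => iD.
    by case: (i =P psi) => [ip|_]; [move: iD; rewrite ip (negbTE psi_notD) | rewrite addr0].
  by case: eqP => _; rewrite ?addr0 ?subrK.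
have y2E : y2 = x2 + e_ c.
  apply/rowP => i; rewrite add_delta !ptE inT; case: ifPn => iD.
    by case: eqVneq => [->|_] /=; [rewrite (negbTE cT) | rewrite addr0].
  by case: (i =P c) => [ic|_]; [move: iD; rewrite ic c_D | rewrite addr0].
have ypt s : y2 + s *: e_ psi = pt (T k.+1) F (F - 1 + s).
  apply/rowP => i; rewrite add_scale_delta !ptE; case: ifPn => iD.
    by case: (i =P psi) => [ip|_]; [move: iD; rewrite ip (negbTE psi_notD) | rewrite mulr0 addr0].
  by case: eqP => _; rewrite ?mulr0 ?mulr1 ?addr0.
have y3E : y2 + e_ psi = y3 by rewrite -[e_ psi]scale1r ypt subrK.
have Ky s : 0 <= s <= 1 + r -> K (y2 + s *: e_ psi).
  move=> /andP[s0 s1]; rewrite ypt; apply: pt_relaxation => //; try lra.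
    by move=> i j; apply: D_Tset_arc.
  by left; apply: DT; apply: c_D.
have Ky2 : K y2 by have := Ky 0; rewrite scale0r addr0; apply; apply/andP; split; lra.
have Ky3 : K y3 by rewrite -y3E -[e_ psi]scale1r; apply: Ky; apply/andP; split; lra.
have Kx1 : K x1 by apply: pt_Tset_relaxation; lra.
have Kx2 : K x2 by apply: pt_Tset_relaxation; lra.
have Kx3 : K (pt (T k) F F) by apply: pt_Tset_relaxation; lra.
have fy2 : feas y2.
  split=> // i iN; rewrite ptE; case: ifP => _; first by case: ifP => _; rewrite ?rpredD ?fl_int ?int_num1.
  case: eqP => _; first by rewrite rpredB ?fl_int ?int_num1.
  by case: (Pvec_feasible adm (T kp.+1)) => /(_ i iN).
have y3P i : y3 0 i <= (P k + e_ c) 0 i.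
  have := pt_le i hk; rewrite add_delta !ptE inT; case: ifPn => iD.
    by case: eqVneq => [->|_] /=; [rewrite (negbTE cT); lra | rewrite addr0].
  by case: (i =P c) => [ic|_]; [move: iD; rewrite ic c_D | rewrite addr0].
have x1P i : x1 0 i <= P k 0 i.
  apply: le_trans (pt_le i hk); rewrite !ptE.
  by case: ifP => _; [case: ifP => _|case: ifP => _]; lra.
have h1 : f (P k + e_ c) - f (P k) <= f (x1 + e_ c) - f x1.
  apply: (DR_relaxation adm X_relaxation f_DR) => //; first exact: (Pvec_relaxation adm).
    by rewrite x2E.
  exact: delta_ge0.
have h2 : f (y2 + e_ psi) - f y2 <= f (x2 + e_ psi) - f x2.
  apply: (DR_relaxation adm X_relaxation f_DR) => //; first by rewrite x3E.
  - by rewrite y3E.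
  - by move=> i; rewrite y2E add_delta lerDl ler0n.
  - exact: delta_ge0.
have e4 : y3 + r *: e_ psi = y2 + (1 + r) *: e_ psi.
  by rewrite -y3E scalerDl scale1r addrA.
have h3 : f (P k + e_ c + r *: e_ psi) - f (P k + e_ c) <= f (y3 + r *: e_ psi) - f y3.
  apply: (DR_relaxation adm X_relaxation f_DR) => //.
  - by rewrite e4; apply: Ky; apply/andP; split; lra.
  - by rewrite -PS; apply: (Pvec_relaxation adm).
  - by move=> i; rewrite mxE mulr_ge0 ?delta_ge0 // ltW.
pose s := (1 + r)^-1; have r1 : 0 < 1 + r by lra.
have h4 : (1 - s) * f y2 + s * f (y2 + (1 + r) *: e_ psi) <= f (y2 + s *: ((1 + r) *: e_ psi)).
  apply: (concave_segment adm X_relaxation f_DR f_bounded) => //.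
  - by apply: Ky; apply/andP; split; lra.
  - by move=> i; rewrite mxE mulr_ge0 ?delta_ge0 // ltW.
  - by rewrite /s invr_ge0 ltW //= invf_le1 //; lra.
  - right; split=> // i iN; rewrite mxE mxE eqxx /=; case: eqP => [ip|_]; last by rewrite mulr0.
    by have := Psi_notN adm pP; rewrite -ip iN.
move: h4; rewrite scalerA /s mulVf ?gt_eqF // scale1r y3E -e4 => h4.
have h5 : r * f y2 + f (y3 + r *: e_ psi) <= (1 + r) * f y3.
  have := ler_wpM2l (ltW r1) h4; rewrite mulrDr !mulrA mulrBr mulr1 mulfV ?gt_eqF //.
  by rewrite mul1r addrAC subrr add0r.
have h6 : frac_jump k / r <= f y3 - f y2.
  by rewrite ler_pdivrMr // /frac_jump PS' PS; move: h3 h5; lra.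
move: h1 h2 h6; rewrite /bonus x2E x3E y3E PS' -/x1; lra.
Qed.

(** Set to 0 outside the waiting period of [psi], so that its increments sum to 0. *)
Definition pending k : R := if (kp < k <= kc)%N then bonus (T k) else 0.

Lemma gap_floor_ind S i : gap N arc u (fun=> 0) floor_ind S i =
  ((i == psi) && (c \notin S))%:R - ((triangle arc S i == Some psi) && (c \notin S))%:R.
Proof. by rewrite /gap aval_floor_ind anch_floor_ind. Qed.

Lemma pending_step (k : 'I_v) :
  pending k.+1 - pending k + (if d k == c then (1 - r) / r * frac_jump k else 0) <=
  gap N arc u (fun=> 0) floor_ind (T k) (d k) / gu k * (f (P k.+1) - f (P k)).
Proof.
have r_gt0 := frac_gt0; rewrite gap_floor_ind /pending.
have pk : pos d (d k) = k := pos_perm d k.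
have dkE i : (d k == i) = (k == pos d i :> nat) by rewrite -(inj_eq (@pos_inj _ d)) pk.
have cTE : (c \notin T k) = (k <= kc)%N by rewrite in_Tset -leqNgt.
rewrite !dkE cTE ltnS.
have [kkp|kkp|kE] := ltngtP k kp.
- have kkc := ltn_trans kkp lt_pos.
  rewrite (ltn_eqF kkc) /= subrr add0r; case: eqP => [t|_] /=; last by rewrite subrr !mul0r.
  have [+ _ _] := triangle_SomeP forest t.
  by rewrite in_Tset ltnNge ltnW.
- have [kkc|kkc|kE] := ltngtP k kc.
  + have hk : (kp < k <= kc)%N by rewrite kkp ltnW.
    have [kD|kD] := boolP (d k \in D).
      have [_ h2 _] := Pvec_pending (d k) hk; have [-> _] := h2 kD (Tset_perm d k).
      rewrite eqxx gu_D // divr1 !addr0.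
      have := bonus_step (k := k); rewrite kkp kkc => /(_ isT kD).
      by move=> h /=; lra.
    case: eqP => [t|_].
      have [_ pi _] := triangle_SomeP forest t; case/negP: kD; apply: below_psi => //.
      by rewrite dkE gtn_eqF.
    rewrite /=; have -> : bonus (T k.+1) = bonus (T k).
      have ptT s s' : pt (T k.+1) s s' = pt (T k) s s'.
        apply/rowP => i; rewrite !ptE; case: ifP => // iD; rewrite TsetS in_setU1.
        by case: eqP => [ik|//]; rewrite -ik iD in kD.
      by rewrite /bonus !ptT.
    by rewrite subrr addr0 subrr !mul0r.
  + by rewrite !andbF /= !subrr addr0 !mul0r.
  + have hk : (kp < k <= kc)%N by rewrite kkp kE leqnn.
    have [dk PS] := Pvec_last kE; have kD : d k \in D by rewrite dk c_D.
    have [_ h2 _] := Pvec_pending (d k) hk; have [-> _] := h2 kD (Tset_perm d k).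
    rewrite eqxx gu_D // divr1 /= sub0r.
    have := bonus_last kE; rewrite /frac_jump.
    set E := f (P k.+1) - f (P k.+1 - r *: e_ psi) => h.
    have -> : (1 - r) / r * E = E / r - E by field; rewrite gt_eqF.
    by move: h; rewrite /E; lra.
- have kkc : (k < kc)%N by rewrite kE.
  have nt : (triangle arc (T k) (d k) == Some psi) = false.
    apply/negbTE/eqP => t; have [+ _ _] := triangle_SomeP forest t.
    by rewrite in_Tset -kE ltnn.
  rewrite nt kkc (ltnW kkc) (ltn_eqF kkc) /= addr0 !subr0 mul1r mulrC.
  by apply: bonus_first.
Qed.

Lemma floor_ind_bound_first (k : 'I_v) : k = kc :> nat ->
  (1 - r) * frac_jump k <= r * \sum_(k < v)
    gap N arc u (fun=> 0) floor_ind (T k) (d k) / gu k * (f (P k.+1) - f (P k)).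
Proof.
move=> kE; have r_gt0 := frac_gt0.
have : \sum_(k < v) (pending k.+1 - pending k + (if d k == c then (1 - r) / r * frac_jump k else 0))
    <= \sum_(k < v) gap N arc u (fun=> 0) floor_ind (T k) (d k) / gu k * (f (P k.+1) - f (P k)).
  by apply: ler_sum => l _; apply: pending_step.
rewrite big_split /= -(big_mkord xpredT (fun k => pending k.+1 - pending k)).
have pv : pending v = 0.
  by rewrite /pending (_ : (v <= kc)%N = false) ?andbF // leqNgt ltn_ord.
have p0 : pending 0 = 0 by [].
rewrite telescope_sumr // pv p0 subrr add0r.
have [dk _] := Pvec_last kE.
rewrite -big_mkcond (big_pred1 k) /=; last first.
  by move=> l; rewrite -dk (inj_eq perm_inj).
have -> : (1 - r) * frac_jump k = r * ((1 - r) / r * frac_jump k).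
  by field; rewrite gt_eqF.
by move=> h; apply: (ler_wpM2l (ltW r_gt0)).
Qed.

End FloorFirst.

Lemma floor_ind_bound :
  (1 - r) * \sum_(k < v) (if (d k == c) && (psi \in T k) then frac_jump k else 0) <=
  r * \sum_(k < v) gap N arc u (fun=> 0) floor_ind (T k) (d k) / gu k *
    (f (P k.+1) - f (P k)).
Proof.
have [lt|lt] := ltnP (pos d psi) (pos d c).
  have := floor_ind_bound_first lt (k := (d^-1)%g c) erefl; apply: le_trans.
  rewrite -big_mkcond (big_pred1 ((d^-1)%g c)) // => k.
  apply/andP/eqP => [[/eqP <- _]|->]; first by rewrite permK.
  by rewrite perm_pos eqxx in_Tset.
have h k : (psi \in T k) -> c \in T k by rewrite !in_Tset; apply: leq_ltn_trans lt.
rewrite [X in _ * X]big1; last first.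
  by move=> k _; case: ifP => // /andP[/eqP dk /h]; rewrite -dk (negbTE (Tset_perm d k)).
rewrite [X in _ <= _ * X]big1 ?mulr0 // => k _; rewrite /gap aval_floor_ind anch_floor_ind.
have -> : (d k == psi) && (c \notin T k) = false.
  apply/negP => /andP[/eqP dk]; rewrite in_Tset -leqNgt => kc.
  have pk : pos d psi = k by rewrite -dk pos_perm.
  have e : pos d c = pos d psi by apply/eqP; rewrite eqn_leq lt pk.
  by have := ch_neq adm pP; rewrite (pos_inj e) eqxx.
case: eqP => [t|_] /=; last by rewrite subrr !mul0r.
by have [/h -> _ _] := triangle_SomeP forest t; rewrite subrr !mul0r.
Qed.

End FractionalVertex.

(** * The DR inequalities at reduced points and at feasible points *)

Section DRInequalityValid.
Context (R : realType) (v : nat) (N : {set 'I_v}) (arc : rel 'I_v) (u : 'rV[R]_v).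
Hypothesis adm : admissible N arc u.
Hypothesis u_below : forall psi i, psi \in Psi N arc u ->
  1 < u 0 psi -> i \in Rplus arc psi -> i != psi -> u 0 i = uceil u psi.
Context (X : set 'rV[R]_v) (X_relaxation : relaxation arc u `<=` X).
Context (f : 'rV[R]_v -> R) (f_DR : DR_submodular X f) (f0 : f 0 = 0).
Hypothesis f_bounded : exists b : R, forall z, feasible N arc u z -> b <= f z.
Context (d : 'S_v).
Hypothesis vd : valid_perm N arc u d.
Implicit Types (i j a b psi : 'I_v) (S A : {set 'I_v}) (s : R).
Local Notation le := (connect arc).
Local Notation Psi := (Psi N arc u).
Local Notation K := (relaxation arc u).
Local Notation feas := (feasible N arc u).
Local Notation forest := (adm_forest adm).
Local Notation fl := (ufloor u).
Local Notation ch := (ch arc).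
Local Notation T k := (Tset d k).
Local Notation P k := (Pvec N arc u (Tset d k)).
Local Notation gap := (gap N arc u).
Local Notation gu k := (gap (u 0) fl (T k) (d k)).
Local Notation anch := (anch N arc u).
Local Notation eta := (eta arc u).
Local Notation e_ i := (delta_mx 0 i : 'rV[R]_v).
Local Notation jump := (frac_jump N arc u f d).

Lemma gap_int (z : 'rV[R]_v) e S i :
  (forall a, reachN N arc a -> a \notin Psi -> z 0 a \is a Num.int) ->
  (forall psi, psi \in Psi -> e psi \is a Num.int) ->
  i \notin S -> reachN N arc i -> ~~ ((i \in Psi) && (ch i \in S)) ->
  gap (z 0) e S i \is a Num.int.
Proof.
move=> zi ei iS ri hi; rewrite /gap rpredB //.
  rewrite /aval; case: ifPn => [/andP[iP _]|h]; first exact: ei.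
  by apply: zi => //; apply/negP => iP; move: hi h; rewrite iP /= => ->.
have [iP|iP] := boolP (i \in Psi); last exact: (anch_int adm).
rewrite mxE; case t: triangle => [a|]; last exact: int_num0.
have [aS ai _] := triangle_SomeP forest t.
have nai : a != i by apply: contraTneq aS => ->.
rewrite /aval (negbTE (above_Psi_notPsi adm iP ai nai)) /=.
apply: zi; first exact: reachN_connect ai ri.
exact: (above_Psi_notPsi adm iP).
Qed.

Lemma stepdir_N S i j : j \in N -> ~~ (reachN N arc i && ~~ ((i \in Psi) && (ch i \in S))) ->
  stepdir N arc u S i 0 j = 0.
Proof.
move=> jN hi; rewrite mxE; case: ifP => [/eqP t|_]; last first.
  by case: ifP => // /and3P[jP _ _]; have := Psi_notN adm jP; rewrite jN.
have [_ ij imax] := triangle_SomeP forest t.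
move: hi; rewrite (reachN_connect ij (N_reachN arc jN)) /= negbK => /andP[iP cS].
have nji : j != i by apply: contraTneq jN => ->; apply: (Psi_notN adm).
have := imax (ch i); rewrite in_setU1 cS orbT => /(_ isT (connect_Psi adm iP ij nji)).
by rewrite (negbTE (ch_nconnect adm iP)).
Qed.

Section Reduced.
Variable z : 'rV[R]_v.
Hypothesis rz : reduced N arc u z.

Definition zfloor i : R := (Num.floor (z 0 i))%:~R.

Local Notation x k := (anch (z 0) zfloor (T k)).

Lemma reduced_anchorable : anchorable N arc u z zfloor.
Proof.
have [[_ Kz] zi _] := rz; have [zb _] := Kz; split=> // psi.
  by move=> pP; rewrite /zfloor floor_le andbT ler0z real_floor_ge0 ?num_real //; case/andP: (zb psi).
move=> a pP ap nap; apply: int_le_floor (relaxation_connect Kz ap).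
apply: zi; first exact: reachN_connect ap (Psi_reachN pP).
exact: (above_Psi_notPsi adm pP).
Qed.

Lemma zfloor_le psi : zfloor psi <= fl psi.
Proof.
have [[_ [zb _]] _ _] := rz; rewrite /zfloor /ufloor ler_int le_floor //.
by case/andP: (zb psi).
Qed.

Lemma zfloor_int psi : zfloor psi \is a Num.int.
Proof. exact: intr_int. Qed.

Lemma reduced_full psi : psi \in Psi -> z 0 psi = u 0 psi ->
  [/\ zfloor psi = fl psi, z 0 (ch psi) = fl psi + 1 & eta psi z = fl psi].
Proof.
move=> pP zu; have [[zN Kz] _ _] := rz.
have zc : z 0 (ch psi) = fl psi + 1.
  apply/eqP; rewrite eq_le -{1}(u_ch adm pP); case: Kz (Kz) => zb _ Kz'.
  case/andP: (zb (ch psi)) => _ -> /=; apply: int_ltD1; rewrite ?fl_int ?zN ?(ch_N adm) //.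
  apply: lt_le_trans (fl_lt pP) _; rewrite -zu.
  exact: (relaxation_connect Kz' (connect_ch adm pP)).
split=> //; first by rewrite /zfloor zu.
have := eta_rel adm z pP; rewrite zu zc => h.
have h1 : 1 - (u 0 psi - fl psi) != 0 by rewrite gt_eqF // subr_gt0; have := u_lt_fl1 u psi; lra.
by apply: (mulfI h1); move: h; lra.
Qed.

(** It equals [z_(ch psi) - z_psi] when [z_psi] is integral, and 0 when [z_psi = u_psi]. This form
    displays the factor [zfloor psi - eta psi z] needed for [floor_ind_bound]. *)
Definition excess psi : R :=
  (zfloor psi - eta psi z) * (1 - (u 0 psi - fl psi)) / (u 0 psi - fl psi).

Lemma excess_full psi : psi \in Psi -> z 0 psi = u 0 psi -> excess psi = 0.
Proof. by move=> pP /(reduced_full pP)[zf _ ef]; rewrite /excess zf ef subrr !mul0r. Qed.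

Lemma excess_int psi : psi \in Psi -> z 0 psi \is a Num.int ->
  zfloor psi = z 0 psi /\ excess psi = z 0 (ch psi) - z 0 psi.
Proof.
move=> pP zi; have zf : zfloor psi = z 0 psi by rewrite /zfloor floorK.
split=> //; rewrite /excess zf; have r0 := fl_lt pP.
apply: (mulIf (x := u 0 psi - fl psi)); first by rewrite gt_eqF // subr_gt0.
rewrite divfK ?gt_eqF ?subr_gt0 //; have := eta_rel adm z pP; lra.
Qed.

Lemma eta_le_zfloor psi : psi \in Psi -> eta psi z <= zfloor psi.
Proof.
move=> pP; have [[_ Kz] _ zp] := rz; case: (zp psi pP) => [zi|zu].
  by have [-> _] := excess_int pP zi; apply: (eta_le adm).
by have [-> _ ->] := reduced_full pP zu.
Qed.

(** Where [z_psi = u_psi], the pair [(z, floor z)] satisfies the relation of [anch_step]; both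
    anchored points then move along one direction and [slope_le] applies. *)
Lemma step_regular (k : 'I_v) :
  (forall psi, psi \in Psi -> psi \in T k -> ch psi = d k -> z 0 psi = u 0 psi) ->
  gap (z 0) zfloor (T k) (d k) / gu k * (f (P k.+1) - f (P k)) <= f (x k.+1) - f (x k).
Proof.
move=> full; have [fz zi _] := rz; set gx := gap (z 0) zfloor (T k) (d k).
have g0 := valid_gap_gt0 adm vd k; set w := stepdir N arc u (T k) (d k).
have PS : P k.+1 = P k + gu k *: w := Pvec_step adm d k.
have xS : x k.+1 = x k + (gx / gu k) *: (gu k *: w).
  rewrite scalerA divfK ?gt_eqF // TsetS; apply: (anch_step adm); first exact: Tset_perm.
  move=> psi pP pT cd; have zu := full psi pP pT cd.
  by have [-> zc _] := reduced_full pP zu; rewrite -cd zc zu; ring.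
have za := reduced_anchorable.
have xP m j : x m 0 j <= P m 0 j by apply: (anch_le za) => psi _; apply: zfloor_le.
have fx m : feas (x m) by apply: (anch_feasible adm za) => // psi _; apply: zfloor_int.
have gx0 : 0 <= gx by apply: (gap_ge0 adm za).
rewrite PS xS; apply: (slope_le adm X_relaxation f_DR f_bounded).
- by case: (fx k).
- exact: (Pvec_relaxation adm).
- by rewrite -xS; case: (fx k.+1).
- by rewrite -PS; apply: (Pvec_relaxation adm).
- by move=> j; rewrite mxE; apply: mulr_ge0; [apply: ltW | apply: stepdir_ge0].
- by rewrite divr_ge0 // ltW.
- exact: xP.
- by rewrite -xS -PS.
(* Either the ratio is a quotient of integers or the direction vanishes on [N]: the two cases of
   [slope_le]. *)
have [/andP[ri hi]|hi] :=
  boolP (reachN N arc (d k) && ~~ ((d k \in Psi) && (ch (d k) \in T k))).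
  left; apply: int_nonneg_ratio => //; apply: gap_int => //; try exact: Tset_perm.
  - by move=> psi _; apply: zfloor_int.
  - by move=> a; apply: reachN_int.
  - by move=> psi _; apply: fl_int.
right; split=> //; first exact: (Pvec_feasible adm).
by move=> j jN; rewrite mxE stepdir_N ?mulr0.
Qed.

(** The anchored point of [z] moves at [ch psi] only, because [psi] already has its integral value.
    The comparison is made with [P k] raised at [ch psi] alone, which leaves out the jump of
    [psi]. *)
Lemma step_jump (k : 'I_v) psi : psi \in Psi -> psi \in T k -> ch psi = d k ->
  z 0 psi \is a Num.int ->
  gap (z 0) zfloor (T k) (d k) / gu k * (f (P k.+1) - f (P k)) -
    excess psi * jump psi k <= f (x k.+1) - f (x k).
Proof.
move=> pP pT cd zpi; have [fz zi _] := rz; have [zN _] := fz.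
have [zf ->] := excess_int pP zpi.
have pk : pos d (ch psi) = k by rewrite cd pos_perm.
have lt_pos : (pos d psi < pos d (ch psi))%N by rewrite pk -in_Tset.
have kE : k = pos d (ch psi) :> nat by rewrite pk.
have cT : ch psi \notin T k by rewrite cd Tset_perm.
have hk : (pos d psi < k <= pos d (ch psi))%N by rewrite pk -in_Tset pT leqnn.
have cD : d k \in [set j | le (ch psi) j]%SET by rewrite inE cd connect0.
have guE : gu k = 1 := gu_D adm u_below vd pP lt_pos hk cD.
have tc := triangle_ch adm pP pT cT.
have gxE : gap (z 0) zfloor (T k) (d k) = z 0 (ch psi) - z 0 psi.
  rewrite /gap mxE -cd tc /aval pP cT /= zf.
  by rewrite (negbTE (ch_notPsi adm pP)).
have xS : x k.+1 = x k + (z 0 (ch psi) - z 0 psi) *: e_ (ch psi).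
  apply/rowP => i; rewrite add_scale_delta !mxE.
  have cS : ch psi \in T k.+1 by rewrite TsetS -cd setU11.
  have [->|nic] := eqVneq i (ch psi).
    rewrite (triangle_self forest cS) tc /aval pP cT /= zf (negbTE (ch_notPsi adm pP)) /=.
    by ring.
  rewrite mulr0 addr0 TsetS -cd (triangleU1_neq forest); last first.
    apply/eqP => t; have [_ ci _] := triangle_SomeP forest t.
    have iT : i \in T k.+1.
      by apply: (D_closed adm u_below vd pP lt_pos _ cS ci); rewrite inE connect0.
    by move: t; rewrite cd -TsetS (triangle_self forest iT) -cd => -[/eqP]; apply/negP.
  case t: (triangle arc (T k) i) => [a|//]; rewrite /aval in_setU1.
  have [aP|//] := boolP (a \in Psi); have [e|ne] /= := eqVneq (ch a) (ch psi); last by [].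
  by rewrite (ch_inj adm aP pP e) cT zf.
have [_ PS] := Pvec_last adm u_below vd pP lt_pos kE.
have PS' : P k.+1 - (u 0 psi - fl psi) *: e_ psi = P k + e_ (ch psi) by rewrite PS addrK.
have za := reduced_anchorable.
have xP j : x k 0 j <= P k 0 j by apply: (anch_le za) => a _; apply: zfloor_le.
have Kx m : K (x m) by apply: (anch_relaxation adm za).
have zcp : 0 <= z 0 (ch psi) - z 0 psi.
  by rewrite subr_ge0; case: fz => _ /relaxation_connect; apply; apply: (connect_ch adm).
have h : (z 0 (ch psi) - z 0 psi) * (f (P k + e_ (ch psi)) - f (P k)) <=
         f (x k + (z 0 (ch psi) - z 0 psi) *: e_ (ch psi)) - f (x k).
  apply: (slope_le adm X_relaxation f_DR f_bounded) => //.
  - exact: (Pvec_relaxation adm).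
  - by rewrite -xS.
  - exact: (last_relaxation adm u_below vd pP lt_pos kE).
  - by move=> j; apply: delta_ge0.
  - move=> j; rewrite add_scale_delta add_delta.
    have [->|_] := eqVneq j (ch psi); last by rewrite mulr0 !addr0.
    have [_ h2 _] := Pvec_pending adm u_below vd pP lt_pos (ch psi) hk.
    have [] := h2 _ cT; first by rewrite inE connect0.
    move=> _ ->; rewrite mxE tc /aval pP cT zf mulr1 addrC subrK -(u_ch adm pP).
    by case: fz => _ [/(_ (ch psi))/andP[]].
  - left; rewrite -[X in nonneg_ratio X]divr1; apply: int_nonneg_ratio => //.
    by rewrite rpredB // zN // (ch_N adm).
rewrite gxE guE divr1 xS; apply: le_trans h.
by rewrite /frac_jump PS' -mulrBr; apply: ler_wpM2l => //; lra.
Qed.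

Lemma DR_reduced : \sum_(k < v) tcoef N arc u d z k * (f (P k.+1) - f (P k)) <= f z.
Proof.
pose w psi k : R := if (d k == ch psi) && (psi \in T k) then jump psi k else 0.
have step (k : 'I_v) : gap (z 0) zfloor (T k) (d k) / gu k * (f (P k.+1) - f (P k)) -
    \sum_(psi in Psi) excess psi * w psi k <= f (x k.+1) - f (x k).
  have [[psi [pP pT cd zi]]|none] := pselect (exists psi, [/\ psi \in Psi, psi \in T k,
      ch psi = d k & z 0 psi \is a Num.int]).
    apply: le_trans (step_jump pP pT cd zi); rewrite lerD2l lerN2 (bigD1 psi) //=.
    rewrite /w cd eqxx pT big1 ?addr0 // => a /andP[aP na].
    by rewrite -cd (inj_in_eq (ch_inj adm)) // eq_sym (negbTE na) mulr0.
  have full psi : psi \in Psi -> psi \in T k -> ch psi = d k -> z 0 psi = u 0 psi.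
    move=> pP pT cd; have [_ _ /(_ _ pP)[zi|//]] := rz.
    by case: none; exists psi.
  rewrite big1 ?subr0; first exact: step_regular.
  move=> psi pP; rewrite /w; case: ifP => [/andP[/eqP cd pT]|_]; last by rewrite mulr0.
  by rewrite (excess_full pP (full psi pP pT (esym cd))) mul0r.
have sum_step : \sum_(k < v) (gap (z 0) zfloor (T k) (d k) / gu k * (f (P k.+1) - f (P k))) -
    \sum_(psi in Psi) excess psi * \sum_(k < v) w psi k <= f z.
  have -> : f z = \sum_(k < v) (f (x k.+1) - f (x k)).
    rewrite -(big_mkord xpredT (fun k => f (x k.+1) - f (x k))) telescope_sumr //.
    by rewrite Tset_full Tset0 (anch_row adm) (anch_set0 adm) f0 subr0.
  apply: le_trans (ler_sum _ (fun k _ => step k)); rewrite sumrB lerD2l lerN2.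
  rewrite exchange_big /=; apply: ler_sum => psi _; by rewrite mulr_sumr.
apply: le_trans sum_step.
pose L psi := \sum_(k < v) gap (fun=> 0) (floor_ind R psi) (T k) (d k) / gu k *
    (f (P k.+1) - f (P k)).
have -> : \sum_(k < v) tcoef N arc u d z k * (f (P k.+1) - f (P k)) =
    \sum_(k < v) (gap (z 0) zfloor (T k) (d k) / gu k * (f (P k.+1) - f (P k))) -
    \sum_(psi in Psi) (zfloor psi - eta psi z) * L psi.
  (* Gaps are linear in [e], and [eta] differs from [zfloor] on [Psi] by a combination of unit
     vectors. *)
  have gapE S i : gap (z 0) (eta^~ z) S i = gap (z 0) zfloor S i -
      \sum_(psi in Psi) (zfloor psi - eta psi z) * gap (fun=> 0) (floor_ind R psi) S i.
    have avE a : aval N arc u (z 0) (eta^~ z) S a = aval N arc u (z 0) zfloor S a -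
        \sum_(psi in Psi) (zfloor psi - eta psi z) * aval N arc u (fun=> 0) (floor_ind R psi) S a.
      under eq_bigr => psi pP do rewrite aval_floor_ind //.
      rewrite /aval; case: ifPn => [/andP[aP cS]|h].
        rewrite (bigD1 a) //= eqxx cS mulr1 big1 ?addr0 ?subKr // => psi /andP[_ na].
        by rewrite eq_sym (negbTE na) mulr0.
      rewrite big1 ?subr0 // => psi pP; case: eqP => [e|_]; last by rewrite mulr0.
      by move: h; rewrite e pP /= => /negbTE ->; rewrite mulr0.
    rewrite /gap mxE; case t: triangle => [a|].
      under eq_bigr => psi pP do rewrite mxE t mulrBr.
      by rewrite mxE t sumrB !avE; ring.
    by under eq_bigr => psi pP do rewrite mxE t subr0; rewrite mxE t !subr0 avE.
  rewrite -[X in _ = _ - X](eq_bigr _ (fun psi _ => esym (mulr_sumr _ _ _ _))).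
  rewrite exchange_big -sumrB; apply: eq_bigr => k _ /=.
  rewrite (tcoef_gap adm) gapE mulrBl mulrBl; congr (_ - _).
  by rewrite -mulrA mulr_suml; apply: eq_bigr => psi _; rewrite -!mulrA.
rewrite lerD2l lerN2; apply: ler_sum => psi pP.
have r0 : 0 < u 0 psi - fl psi by rewrite subr_gt0 (fl_lt pP).
have := floor_ind_bound adm u_below X_relaxation f_DR f_bounded vd pP.
rewrite -/(w psi _) -/(L psi) => h.
(* This factor turns the left side of [floor_ind_bound] into [excess] times the jumps and the right
   side into the correction from [eta]. *)
have e0 : 0 <= (zfloor psi - eta psi z) / (u 0 psi - fl psi).
  by rewrite divr_ge0 ?(ltW r0) // subr_ge0 eta_le_zfloor.
have := ler_wpM2l e0 h; congr (_ <= _); rewrite /excess; last by field; rewrite gt_eqF.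
by rewrite /w; ring.
Qed.

End Reduced.

Lemma DR_feasible z : feas z -> DR_inequality N arc u f d z (f z).
Proof.
apply: (le_reduced adm X_relaxation f_DR f_bounded
  (L := fun z => \sum_(k < v) tcoef N arc u d z k * (f (P k.+1) - f (P k)))).
  move=> c y y'; rewrite mulr_sumr -big_split; apply: eq_bigr => k _ /=.
  by rewrite (tcoef_lin adm) mulrDl mulrA.
exact: DR_reduced.
Qed.

End DRInequalityValid.

(** * The convex hull *)

Section HullInPolyhedron.
Context (R : realType) (v : nat) (N : {set 'I_v}) (arc : rel 'I_v) (u : 'rV[R]_v).
Hypothesis adm : admissible N arc u.
Implicit Types (i j psi : 'I_v) (z : 'rV[R]_v).
Local Notation fl := (ufloor u).

(** Integrality of [z_(ch psi)] leaves two cases. If it is at most [floor u_psi], then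
    [eta_psi <= z_psi] suffices; otherwise it is [floor u_psi + 1], and [z_psi <= u_psi] gives the
    bound. *)
Lemma MIR_feasible psi z : psi \in Psi N arc u -> feasible N arc u z ->
  MIR_inequality arc u psi z.
Proof.
move=> pP [zN Kz]; apply/(MIR_eta adm z pP); have [zb _] := Kz.
have zc : z 0 (ch arc psi) \is a Num.int by rewrite zN // (ch_N adm).
have [zl|zg] := leP (z 0 (ch arc psi)) (fl psi).
  apply: le_trans (eta_le adm Kz pP) (le_trans _ zl).
  exact: relaxation_connect Kz (connect_ch adm pP).
have zE : z 0 (ch arc psi) = fl psi + 1.
  apply/eqP; rewrite eq_le int_ltD1 ?fl_int // -(u_ch adm pP) andbT.
  by case/andP: (zb (ch arc psi)).
have /andP[_ zu] := zb psi; have := eta_rel adm z pP; rewrite zE.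
have := fl_lt pP; have := u_lt_fl1 u psi.
by move=> h1 h2 h3; rewrite leNgt; apply/negP => h4; nra.
Qed.

Lemma linear_sum_scale (L : 'rV[R]_v -> R) (k : nat) (c : 'I_k -> R) (x : 'I_k -> 'rV[R]_v) :
  (forall a y z, L (a *: y + z) = L z + a * L y) ->
  L (\sum_j c j *: x j) = \sum_j c j * L (x j).
Proof.
move=> Llin; have L0 : L 0 = 0.
  by have := Llin 1 0 0; rewrite scaler0 addr0 mul1r; lra.
by apply: (big_rec2 (fun a b => L a = b)) => // j a b _ <-; rewrite Llin addrC.
Qed.

End HullInPolyhedron.

Theorem theorem7p1 (R : realType) (n m : nat)
    (N M : {set 'I_(n + m)}) (cardN : #|N| = n) (cardM : #|M| = m)
    (partNM : M = (~: N)%SET)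
    (arc : rel 'I_(n + m)) (u : 'rV[R]_(n + m))
    (adm : admissible N arc u)
    (u_below : forall psi i : 'I_(n + m), psi \in Psi N arc u ->
       1 < u 0 psi -> i \in Rplus arc psi -> i != psi ->
       u 0 i = uceil u psi)
    (X : set 'rV[R]_(n + m)) (X_relaxation : relaxation arc u `<=` X)
    (f : 'rV[R]_(n + m) -> R) (f_DR : DR_submodular X f) (f0 : f 0 = 0)
    (* [f] is bounded below on the feasible set; the conclusion implies this,
       and without it discontinuous additive functions are counterexamples. *)
    (f_bounded : exists b : R, forall z, feasible N arc u z -> b <= f z) :
  convex_hull (epigraph N arc u f) =
  [set zw : 'rV[R]_(n + m) * R^o |
    [/\ forall i, 0 <= zw.1 0 i <= u 0 i,
        forall i j, arc i j -> zw.1 0 i - zw.1 0 j <= 0,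
        forall psi, psi \in Psi N arc u -> MIR_inequality arc u psi zw.1
      & forall d : 'S_(n + m), valid_perm N arc u d ->
          DR_inequality N arc u f d zw.1 zw.2]].
Proof.
apply/seteqP; split => [[z w]|[z w] /= [zb zm mir dr]]; last first.
  apply: (polyhedron_sub_hull adm f0) => //.
  by split=> // i j ij; rewrite -subr_le0 zm.
move=> [k [c [p [c0 c1 Ap zwE]]]].
have : (z, w) = (\sum_j c j *: (p j).1, \sum_j c j *: (p j).2) :> 'rV[R]_(n + m) * R^o.
  by rewrite zwE -sum_pair; apply: eq_bigr => j _; case: (p j).
move=> [zE wE] /=.
have pK j : relaxation arc u (p j).1 by case: (Ap j) => -[].
have zcoord i : z 0 i = \sum_j c j * (p j).1 0 i.
  by rewrite zE summxE; apply: eq_bigr => j _; rewrite mxE.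
have avg (t : R) : t = \sum_j c j * t by rewrite -mulr_suml c1 mul1r.
split=> [i|i j ij|psi pP|d vd].
- rewrite zcoord sumr_ge0 /=; last by move=> j _; rewrite mulr_ge0 //; case: (pK j) => /(_ i)/andP[].
  rewrite [leRHS]avg; apply: ler_sum => j _; rewrite ler_wpM2l //.
  by case: (pK j) => /(_ i)/andP[].
- rewrite subr_le0 !zcoord; apply: ler_sum => l _; rewrite ler_wpM2l //.
  by case: (pK l) => _; apply.
- apply/(MIR_eta adm z pP); rewrite zE.
  rewrite (linear_sum_scale (L := eta arc u psi)) => [|a y y']; last exact: eta_lin.
  rewrite [leRHS]avg; apply: ler_sum => j _; rewrite ler_wpM2l //.
  by apply/(MIR_eta adm _ pP)/(MIR_feasible adm pP); case: (Ap j).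
rewrite /DR_inequality zE wE; pose L y := \sum_(k < n + m) tcoef N arc u d y k *
  (f (Pvec N arc u (Tset d k.+1)) - f (Pvec N arc u (Tset d k))).
have := @linear_sum_scale R (n + m) L k c (fun j => (p j).1).
rewrite /L => -> => [|a y y']; last first.
  rewrite mulr_sumr -big_split; apply: eq_bigr => l _ /=.
  by rewrite (tcoef_lin adm) mulrDl mulrA.
apply: ler_sum => j _; apply: ler_wpM2l => //.
have [fp fw] := Ap j; apply: le_trans fw.
exact: (DR_feasible adm u_below X_relaxation f_DR f0 f_bounded vd fp).
Qed.
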